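(* Let $n\ge 1$ and let $A=(a_{ij})_{1\le i<j\le 2n}$ be the generic skew-symmetric matrix, whose entries $a_{ij}$ $(i<j)$ are independent indeterminates. The TL-pfaffinants $\{\mathrm{Pfaf}_D(A)\mid D\in\mathcal{T}^e_n\}$ form a basis of the real vector space $P_n$.
   Context: Pfaffians. $[2n]=\{1,\dots,2n\}$. A skew-symmetric matrix is identified with the array $(a_{ij})_{i<j}$ of its entries above the diagonal. $F_{2n}$ is the set of perfect matchings $\pi$ of $[2n]$, and $a_\pi=\prod_{(i<j)\in\pi}a_{ij}$. The pfaffian is $\mathrm{pf}(A)=\sum_{\pi\in F_{2n}}(-1)^{\mathrm{cn}(\pi)}a_\pi$, where $\mathrm{cn}(\pi)$ is the number of crossings of the arcs of $\pi$ when the vertices are placed in order on a line and the edges drawn as arcs above it. For $I\subset[2n]$ of even size, $\mathrm{pf}_I(A)$ is the pfaffian of the submatrix with rows and columns in $I$ ($\mathrm{pf}_\emptyset=1$), $\bar I=[2n]\setminus I$, and $\mathrm{pf}_{I,\bar I}(A)=\mathrm{pf}_I(A)\,\mathrm{pf}_{\bar I}(A)$. $P_n\subset\mathbb{R}[a_{ij}:1\le i<j\le 2n]$ is the real linear span of all $\mathrm{pf}_{I,\bar I}(A)$ with $I\subset[2n]$ of even cardinality (including $I=\emptyset$). Symmetric TL-diagrams. Place points $1,\dots,2n$ on the left side and $1',\dots,(2n)'$ on the right side of a rectangle, numbered from top to bottom. A TL-diagram is a non-crossing perfect matching of these $4n$ points (drawn inside the rectangle); it is symmetric if invariant under the mirror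 reflection $i\leftrightarrow i'$. Then every edge is either horizontal, of the form $(i,i')$, or belongs to a mirror pair of vertical edges $\{(i,j),(i',j')\}$. The order $|D|$ is the number of edges with both ends on the left side. $\mathcal{T}_n$ is the set of symmetric TL-diagrams and $\mathcal{T}^e_n$ the subset of those with $|D|$ even. Diagram pfaffinants. For $\pi\in F_{2n}$ let $\nu(\pi)$ be the matching of $[2n]\cup[2n]'$ with edges $(i,j')$ and $(i',j)$ for each $(i,j)\in\pi$. Fix for each $\pi$ a nice embedding of $\nu(\pi)$: all edges lie in the rectangle, every pair of edges meets at most once, the picture is mirror symmetric, no two edges are tangent, no three edges pass through one point. An unpaired crossing is a crossing of $(i,j')$ with its mirror image $(i',j)$; all other crossings come in mirror-symmetric pairs (paired crossings). Each edge joins the left side to the right side, so at a crossing of two edges there are two half-edges leading to left endpoints and two leading to right endpoints. The vertical uncrossing replaces the crossing by one strand joining the two left half-edges and one joining the two right half-edges (picture '')(''); the horizontal uncrossing joins the left half-edge of each edge to the right half-edge of the other edge without crossing. $X(\pi)$ is the set of diagrams obtained by uncrossing every crossing of $\nu(\pi)$ in one of the two ways, the two members of a paired crossing being uncrossed in the same way. Each $x\in X(\pi)$ is mirror symmetric, and is topologically an element $D(x)\in\mathcal{T}_n$ together with some closed loops. Set $\mathrm{wt}(x)=2^{l(x)}(-1)^{\mathrm{uv}(x)+\mathrm{ph}(x)}$, where $l(x)$ is the number of closed loops (a pair of mirror-symmetric loops counted once), $\mathrm{uv}(x)$ the number of unpaired crossings uncrossed vertically, and $\mathrm{ph}(x)$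 the number of pairs of paired crossings uncrossed horizontally. Put $f_D(\pi)=\sum_{x\in X(\pi),\,D(x)=D}\mathrm{wt}(x)$ and $\mathrm{Pfaf}'_D(A)=\sum_{\pi\in F_{2n}}f_D(\pi)\,a_\pi$ for $D\in\mathcal{T}_n$. TL-pfaffinants. A vertical left edge $(i,j)$ with $i<j$ is odd if $i$ is odd, even otherwise. For $D\in\mathcal{T}_n$, $S(D)$ is the set of all diagrams in $\mathcal{T}_n$ obtained from $D$ by erasing several (possibly zero) odd edges and their mirror images, and matching the resulting unmatched vertices by horizontal edges $(i,i')$. For $D\in\mathcal{T}^e_n$, $\mathrm{Pfaf}_D(A)=\sum_{D'\in S(D)}\mathrm{Pfaf}'_{D'}(A)$. *)

(* Defs.v *)
From HB Require Import structures.
From mathcomp Require Import all_boot all_order all_algebra.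
From mathcomp Require Import reals.
From mathcomp.multinomials Require Import mpoly.
Set Implicit Arguments.
Unset Strict Implicit.
Unset Printing Implicit Defensive.
Import GRing.Theory.
Local Open Scope ring_scope.

(* The vertices 1, ..., N of the mathematics are the elements 0, ..., N.-1 of
   'I_N, so parities are shifted by one. *)

Section Linear.
Variables (F : fieldType) (V : lmodType F) (J : finType).
Implicit Types (S : {set J}) (v : J -> V).

Definition lin_span S v (p : V) : Prop :=
  exists c : J -> F, p = \sum_(j in S) c j *: v j.

Definition lin_indep S v : Prop :=
  forall c : J -> F, \sum_(j in S) c j *: v j = 0 -> forall j, j \in S -> c j = 0.

(* The family (v j), j \in S, is a basis of the subspace P; as a family, so in
   particular j |-> v j is injective on S. *)
Definition is_basis S v (P : V -> Prop) : Prop :=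
  [/\ forall j, j \in S -> P (v j),
      lin_indep S v
    & forall p, P p -> lin_span S v p].

End Linear.

(* A perfect matching is encoded by its partner function, a fixed-point-free
   involution: its edges are the pairs {x, f x}. *)
Definition matchings (T : finType) : {set {ffun T -> T}} :=
  [set f : {ffun T -> T} | [forall x, (f (f x) == x) && (f x != x)]].

Section Pfaffian.
Variables (K : comNzRingType) (N : nat).
Implicit Types (pi : {ffun 'I_N -> 'I_N}) (A : 'M[K]_N) (I : {set 'I_N}).

(* A crossing is a pair of arcs (i, pi i), (k, pi k) with
   i < k < pi i < pi k; it is recorded by the pair (i, k). *)
Definition cn pi : nat :=
  #|[set ik : 'I_N * 'I_N |
      [&& ik.1 < ik.2, ik.2 < pi ik.1 & pi ik.1 < pi ik.2]%N]|.

Definition entry_prod A pi : K := \prod_(i < N | (i < pi i)%N) A i (pi i).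

End Pfaffian.

Definition pf (K : comNzRingType) (N : nat) (A : 'M[K]_N) : K :=
  \sum_(pi in matchings 'I_N) (-1) ^+ cn pi * entry_prod A pi.

(* enum_val lists the elements of I in increasing order. *)
Definition pf_sub (K : comNzRingType) (N : nat) (A : 'M[K]_N)
    (I : {set 'I_N}) : K :=
  pf (\matrix_(s < #|I|, t < #|I|) A (enum_val s) (enum_val t)).

Definition pf_compl (K : comNzRingType) (N : nat) (A : 'M[K]_N)
    (I : {set 'I_N}) : K :=
  pf_sub A I * pf_sub A (~: I).

(* Positions above the diagonal; they index the indeterminates. *)
Notation upper N := {ij : 'I_N * 'I_N | (ij.1 < ij.2)%N}.

Notation generic_ring R N := {mpoly R[#|{: upper N}|]}.

Definition indet (R : nzRingType) (N : nat) (i j : 'I_N) : generic_ring R N :=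
  if (insub (i, j) : option (upper N)) is Some p then 'X_(enum_rank p) else 0.

(* At most one of the two terms is nonzero: the entry (i, j) is the
   indeterminate a_ij if i < j, and - a_ji if j < i. *)
Definition generic_skew (R : nzRingType) (N : nat) : 'M[generic_ring R N]_N :=
  \matrix_(i, j) (indet R i j - indet R j i).

Definition pf_space (R : fieldType) (N : nat) : generic_ring R N -> Prop :=
  lin_span [set I : {set 'I_N} | ~~ odd #|I|] (pf_compl (generic_skew R N)).

(* inl i is the left point i, inr i the right point i'. *)
Notation point N := ('I_N + 'I_N)%type.
Notation diagram N := {ffun point N -> point N}.

Section Diagrams.
Variable N : nat.
Implicit Types (p q : point N) (D : diagram N).

Definition mirror p : point N :=
  match p with inl i => inr i | inr i => inl i end.

Definition label p : 'I_N := match p with inl i | inr i => i end.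

(* Rank of p when the boundary of the rectangle is read down the left side and
   then up the right side. *)
Definition rim p : nat :=
  match p with inl i => i | inr i => (N + (N - i.+1))%N end.

Definition noncrossing D : bool :=
  [forall p, forall q,
    ~~ [&& rim p < rim q, rim q < rim (D p) & rim (D p) < rim (D q)]%N].

Definition symTL : {set diagram N} :=
  [set D in matchings (point N) |
    noncrossing D && [forall p, D (mirror p) == mirror (D p)]].

(* The vertical left edges, as pairs (i, j) with i < j. *)
Definition left_edges D : {set 'I_N * 'I_N} :=
  [set ij : 'I_N * 'I_N | (ij.1 < ij.2)%N && (D (inl ij.1) == inl ij.2)].

Definition TL_order D : nat := #|left_edges D|.

Definition even_symTL : {set diagram N} := [set D in symTL | ~~ odd (TL_order D)].

(* (i, j) is odd if its first vertex is odd when counting from 1. *)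
Definition odd_edges D : {set 'I_N * 'I_N} :=
  [set ij in left_edges D | ~~ odd ij.1].

Definition erase D (E : {set 'I_N * 'I_N}) : diagram N :=
  [ffun p => if [exists ij : 'I_N * 'I_N in E, (label p == ij.1) || (label p == ij.2)]
             then mirror p else D p].

Definition erasures D : {set diagram N} :=
  [set D' in symTL |
    [exists E : {set 'I_N * 'I_N}, (E \subset odd_edges D) && (D' == erase D E)]].

End Diagrams.

(* nu(pi) joins i to j' and i' to j for each edge (i, j) of pi. *)
Definition nu (N : nat) (pi : {ffun 'I_N -> 'I_N}) : diagram N :=
  [ffun p => match p with inl i => inr (pi i) | inr i => inl (pi i) end].

(* Drawings are taken up to isotopy, and recorded by wiring diagrams: the
   rectangle is cut into vertical strips, and between two consecutive strips the
   N edges are at the heights 0, ..., N.-1 (from top to bottom).  A strip is an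
   involution of the heights moving each of them by at most one: the two edges
   at heights h and h.+1 exchanged by it cross inside the strip (transversally,
   away from all other edges), the others go straight.  The edges of nu(pi)
   all go from left to right and pairwise meet at most once, so that any nice
   embedding is isotopic to such a picture; cutting the left half of the
   rectangle first makes the sequence of strips symmetric, the middle strip
   containing the crossings on the axis. *)
Notation strip N := {ffun 'I_N -> 'I_N}.

Definition is_strip (N : nat) (s : strip N) : bool :=
  [forall h, (s (s h) == h) && (s h <= h.+1)%N].

Section Embedding.
Variables (N : nat) (ss : seq (strip N)).
Implicit Types (c : 'I_(size ss)) (h e : 'I_N) (pi : {ffun 'I_N -> 'I_N}).

Definition strip_at c : strip N := tnth (in_tuple ss) c.

(* Height of the edge starting at the left point e, after k strips. *)
Definition height (k : nat) e : 'I_N :=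
  foldl (fun h (s : strip N) => s h) e (take k ss).

Definition nb_meet (e f : 'I_N) : nat :=
  #|[set c : 'I_(size ss) | strip_at c (height c e) == height c f]|.

Definition nice_embedding pi : Prop :=
  [/\ all (@is_strip N) ss,
      rev ss = ss,
      forall e, nu pi (inl e) = inr (height (size ss) e)
    & forall e f, e != f -> (nb_meet e f <= 1)%N].

(* The crossing of the edges at heights h and h.+1 in strip c is the pair
   (c, h). *)
Notation place := ('I_(size ss) * 'I_N)%type.

Definition crossings : {set place} :=
  [set x : place | (x.2 < strip_at x.1 x.2)%N].

Definition mirror_crossing (x : place) : place := (rev_ord x.1, x.2).

(* The two edges at the crossing are (e, (pi e)') and its mirror image
   (pi e, e'). *)
Definition unpaired pi : {set place} :=
  [set x in crossings |
    [exists e, (height x.1 e == x.2) &&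
               (height x.1 (pi e) == strip_at x.1 x.2)]].

Definition paired pi : {set place} := crossings :\: unpaired pi.

(* An element of X(pi) is given by its set of vertically uncrossed crossings,
   all other crossings being uncrossed horizontally. *)
Definition states : {set {set place}} :=
  [set x : {set place} |
    (x \subset crossings) &&
    [forall y in crossings, (mirror_crossing y \in x) == (y \in x)]].

(* The strands of the uncrossed picture are cut at the strip boundaries: the
   node (k, h) is the point at height h after k strips. *)
Notation node := ('I_(size ss).+1 * 'I_N)%type.

(* The height h takes part, in strip c, in a vertically uncrossed crossing. *)
Definition vertical (x : {set place}) c h : bool :=
  ((c, h) \in x) || ((c, strip_at c h) \in x).

(* In strip c, a vertical uncrossing joins the two nodes at its left and the two
   nodes at its right; a horizontal one joins nodes of equal heights, as does a
   height without crossing. *)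
Definition joined (x : {set place}) (u w : node) : bool :=
  [exists c : 'I_(size ss),
    if vertical x c u.2 then
      [&& w.1 == u.1, w.2 == strip_at c u.2 & (u.1 == c :> nat) || (u.1 == c.+1 :> nat)]
    else
      (w.2 == u.2) && (((u.1 == c :> nat) && (w.1 == c.+1 :> nat))
                       || ((u.1 == c.+1 :> nat) && (w.1 == c :> nat)))].

Definition component (x : {set place}) (u : node) : {set node} :=
  [set w | connect (joined x) u w].

Definition end_node (p : point N) : node :=
  match p with inl i => (ord0, i) | inr i => (ord_max, i) end.

(* D(x): each point is matched with the other end of its strand. *)
Definition state_diagram (x : {set place}) : diagram N :=
  [ffun p => odflt p
    [pick q | (q != p) && (end_node q \in component x (end_node p))]].

(* Closed loops are the components reaching neither side of the rectangle. *)
Definition loops (x : {set place}) : {set {set node}} :=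
  [set component x u | u : node & [forall p, end_node p \notin component x u]].

Definition mirror_node (u : node) : node := (rev_ord u.1, u.2).

(* A loop and its mirror image are counted once. *)
Definition nb_loops (x : {set place}) : nat :=
  #|[set L :|: [set mirror_node u | u in L] | L : {set node} in loops x]|.

Definition uv pi (x : {set place}) : nat := #|unpaired pi :&: x|.

(* Number of pairs {y, mirror image of y} of paired crossings uncrossed
   horizontally. *)
Definition ph pi (x : {set place}) : nat :=
  #|[set [set y; mirror_crossing y] | y in paired pi :\: x]|.

Definition wt pi (x : {set place}) : int :=
  2 ^+ nb_loops x * (-1) ^+ (uv pi x + ph pi x).

Definition coeff pi (D : diagram N) : int :=
  \sum_(x in states | state_diagram x == D) wt pi x.

End Embedding.

Section Pfaffinants.
Variables (K : comNzRingType) (N : nat).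
Variable emb : {ffun 'I_N -> 'I_N} -> seq (strip N).
Implicit Types (A : 'M[K]_N) (D : diagram N).

Definition diagram_pfaf A D : K :=
  \sum_(pi in matchings 'I_N) entry_prod A pi *~ coeff (emb pi) pi D.

Definition TL_pfaf A D : K := \sum_(D' in erasures D) diagram_pfaf A D'.

End Pfaffinants.

(* Main.v *)
Require Import Defs.
From mathcomp Require Import all_boot all_order all_algebra zify perm.
From mathcomp Require Import reals.
From mathcomp.multinomials Require Import mpoly.
Set Implicit Arguments.
Unset Strict Implicit.
Unset Printing Implicit Defensive.

(* Colour the strands of an uncrossed picture of nu(pi) by the direction in
   which they are followed.  A symmetric picture has 2^(number of loops)
   colourings with prescribed end colours I, or none, so the sum of the
   Pfaf'_D over the diagrams D whose vertical edges join I to its complement is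
   a sum over coloured pictures.  For a fixed colouring, the two uncrossings of
   a crossing cancel unless the colours follow the edges of nu(pi); what remains
   is the product of the pfaffians of I and of its complement.

   A symmetric diagram is a noncrossing perfect matching m of the left points
   together with a set of erased outer edges, and erasing odd edges amounts to
   erasing more outer edges of m.  Hence the product for I is the sum of the
   TL-pfaffinants of the diagrams in which the erased edges are exactly the
   edges of m not joining I to its complement.  For I the set of openers of a
   diagram this system is unitriangular, so that the TL-pfaffinants lie in the
   span of the products.  They are linearly independent because the products
   can be evaluated at a skew matrix with equal rows at the two ends of each
   vertical edge of D: such a product vanishes unless I separates these ends. *)

(** The uncrossed pictures are finite graphs of degree at most two, so topological facts have to be
    replaced by counts; that state diagrams are noncrossing becomes a parity argument. A strand
    reverses its direction exactly at a vertical uncrossing, where its height changes by one.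
    Direction plus parity of the height is thus constant along it, which is why I enters only
    through a parity twist. Parity also explains which edges can be erased: an edge and the
    innermost arc over it open at vertices of opposite parity, so an odd edge that is not outer lies
    under an even edge, which stays and would be crossed by the new horizontal edges. The
    restriction to even order reflects the evenness of I, which contains one end of each vertical
    edge and both ends or none of each erased outer edge. The same evenness lets the openers be
    paired off in the matrix used for independence. *)

Section Generic.
Variable T : finType.

(** The fibre of y |-> {y, f y} over such a pair is the pair itself, of size two. Used to count
    mirror pairs of crossings and, through the next lemma, for most parity arguments. *)
Lemma card_orbit_pairs (A : {set T}) (f : T -> T) :
    {in A, forall y, f y \in A} -> {in A, forall y, f (f y) = y} ->
    {in A, forall y, f y != y} ->
  #|[set [set y; f y] | y in A]|.*2 = #|A|.
Proof.
move=> fA fK fN; rewrite -[RHS]sum1_card.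
rewrite (partition_big_imset (fun y => [set y; f y])) /= -muln2 -sum_nat_const.
apply: eq_bigr => B /imsetP[y yA ->].
rewrite sum1dep_card (_ : [set _ | _] = [set y; f y]) ?cards2 1?eq_sym ?fN //.
apply/setP=> z; rewrite inE in_set2.
apply/andP/orP => [[zA /eqP/setP/(_ z)]|[]/eqP->].
- by rewrite !in_set2 eqxx /= => /esym/orP.
- by rewrite yA eqxx.
- by rewrite fA // fK // setUC eqxx.
Qed.

Lemma odd_card_fpf (A : {set T}) (f : T -> T) :
    {in A, forall y, f y \in A} -> {in A, forall y, f (f y) = y} ->
    {in A, forall y, f y != y} -> odd #|A| = false.
Proof. by move=> fA fK fN; rewrite -(card_orbit_pairs fA fK fN) odd_double. Qed.

Variable e : rel T.
Hypothesis deg2 : forall u a b c, e u a -> e u b -> e u c -> [\/ a = b, a = c | b = c].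
Hypothesis e_sym : ssrbool.symmetric e.
Definition terminal z := forall a b, e z a -> e z b -> a = b.

(** The vertex [v], from which both paths come, uses up one of the at most two neighbours of [u], so
    the paths cannot part at [u]. *)
Let path_fork v u p q : e u v -> path e u p -> path e u q ->
  uniq (v :: u :: p) -> uniq (v :: u :: q) ->
  terminal (last u p) -> terminal (last u q) -> last u p = last u q.
Proof.
elim: p q v u => [|a p IH] [|b q] v u //= euv.
- move=> _ /andP[eub _] _ /andP[+ _] tu _.
  by rewrite (tu _ _ euv eub) !inE eqxx orbT.
- move=> /andP[eua _] _ /andP[+ _] _ _ tu.
  by rewrite (tu _ _ euv eua) !inE eqxx orbT.
move=> /andP[eua pp] /andP[eub pq] /andP[vp up] /andP[vq uq].
have [va|vb|ab] := deg2 euv eua eub.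
- by move: vp; rewrite va !inE eqxx orbT.
- by move: vq; rewrite vb !inE eqxx orbT.
by subst b; apply: (IH q u a) => //; rewrite e_sym.
Qed.

(** Components of a graph of degree at most two are paths or cycles, so a terminal is connected to
    at most one other terminal. *)
Lemma connect_terminals z1 z2 z3 :
    terminal z1 -> terminal z2 -> terminal z3 ->
    connect e z1 z2 -> connect e z1 z3 -> z1 != z2 -> z1 != z3 -> z2 = z3.
Proof.
move=> t1 t2 t3 /connectP[p0 pp0 E2] /connectP[q0 pq0 E3]; subst z2 z3; move: t2 t3.
case/shortenP: pp0 => p pp up _; case/shortenP: pq0 => q pq uq _ t2 t3.
case: p pp up t2 => [|a p]; first by rewrite eqxx.
case: q pq uq t3 => [|b q]; first by rewrite eqxx.
move=> /= /andP[ezb pq] uq t3 /andP[eza pp] up t2 _ _.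
have ab := t1 _ _ eza ezb; subst b.
by apply: (path_fork (v := z1)) => //; rewrite e_sym.
Qed.

End Generic.

(** * Wiring diagrams and their states *)

Section Strips.
Variables (N : nat) (ss : seq (strip N)).
Hypotheses (ss_strip : all (@is_strip N) ss) (ss_rev : rev ss = ss).
Local Notation node := ('I_(size ss).+1 * 'I_N)%type.
Local Notation place := ('I_(size ss) * 'I_N)%type.
Implicit Types (c : 'I_(size ss)) (h e f : 'I_N) (x : {set place}) (u w : node).

Lemma strip_at_nth c : strip_at c = nth [ffun h => h] ss c.
Proof. exact: tnth_nth. Qed.

Lemma strip_atP c : is_strip (strip_at c).
Proof. by rewrite strip_at_nth (allP ss_strip) ?mem_nth. Qed.

Lemma strip_atK c : involutive (@strip_at N ss c).
Proof. by move=> h; have /forallP/(_ h)/andP[/eqP] := strip_atP c. Qed.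

Lemma strip_at_le c h : (strip_at c h <= h.+1)%N.
Proof. by have /forallP/(_ h)/andP[] := strip_atP c. Qed.

Lemma strip_at_ge c h : (h <= (strip_at c h).+1)%N.
Proof. by have := strip_at_le c (strip_at c h); rewrite strip_atK. Qed.

Lemma strip_at_rev c : strip_at (rev_ord c) = strip_at c.
Proof.
by have := nth_rev [ffun h => h] (ltn_ord c); rewrite ss_rev !strip_at_nth.
Qed.

Lemma height0 e : height ss 0 e = e.
Proof. by rewrite /height take0. Qed.

Lemma heightS c e : height ss c.+1 e = strip_at c (height ss c e).
Proof.
by rewrite /height (take_nth [ffun h => h]) // -cats1 foldl_cat /= strip_at_nth.
Qed.

Lemma height_inj k : (k <= size ss)%N -> injective (height ss k).
Proof.
elim: k => [_ e f|k IH lk e f]; first by rewrite !height0.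
by rewrite !(heightS (Ordinal lk)) => /(can_inj (strip_atK _)); apply/IH/ltnW.
Qed.

(** The mirror image of the edge starting at [e] starts at the end height of [e]. Since the strips
    form a palindrome, it is after [size ss - k] strips where [e] is after [k]. *)
Lemma height_rev e k : involutive (height ss (size ss)) -> (k <= size ss)%N ->
  height ss (size ss - k) (height ss (size ss) e) = height ss k e.
Proof.
move=> hK; elim: k => [_|k IH lk]; first by rewrite subn0 hK height0.
have Ek : (size ss - k = (rev_ord (Ordinal lk)).+1)%N by rewrite /=; lia.
have := IH (ltnW lk); rewrite Ek (heightS (rev_ord (Ordinal lk))) strip_at_rev.
by rewrite (heightS (Ordinal lk)) => <-; rewrite strip_atK.
Qed.

End Strips.

Section States.
Variables (N : nat) (ss : seq (strip N)).
Hypotheses (ss_strip : all (@is_strip N) ss) (ss_rev : rev ss = ss).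
Local Notation node := ('I_(size ss).+1 * 'I_N)%type.
Implicit Types (c : 'I_(size ss)) (h e f : 'I_N) (u w : node).

Lemma mirror_nodeK : involutive (@mirror_node N ss).
Proof. by case=> k h; rewrite /mirror_node /= rev_ordK. Qed.

Lemma mirror_crossingK : involutive (@mirror_crossing N ss).
Proof. by case=> k h; rewrite /mirror_crossing /= rev_ordK. Qed.

Lemma mirror_crossing_in y : (mirror_crossing y \in crossings ss) = (y \in crossings ss).
Proof. by rewrite !inE /= strip_at_rev. Qed.

Section State.
Variable x : {set 'I_(size ss) * 'I_N}.
Hypothesis xS : x \in states ss.

Lemma state_sub : x \subset crossings ss.
Proof. by move: xS; rewrite inE => /andP[]. Qed.

Lemma state_mirror y : (mirror_crossing y \in x) = (y \in x).
Proof.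
move: xS; rewrite inE => /andP[sx /forallP/(_ y)/implyP xm].
case yC: (y \in crossings ss); first exact/eqP/xm.
rewrite !(contraFF (subsetP sx _)) // mirror_crossing_in //.
Qed.

Lemma vertical_strip c h : vertical x c (strip_at c h) = vertical x c h.
Proof. by rewrite /vertical strip_atK // orbC. Qed.

Lemma vertical_rev c h : vertical x (rev_ord c) h = vertical x c h.
Proof.
rewrite /vertical strip_at_rev // -(state_mirror (c, h)).
by rewrite -(state_mirror (c, strip_at c h)).
Qed.

Lemma vertical_neq c h : vertical x c h -> strip_at c h != h.
Proof.
rewrite neq_ltn => /orP[] /(subsetP state_sub); rewrite inE /= ?strip_atK // => -> //.
exact: orbT.
Qed.

(** For [u.1] one of [c] and [c.+1], the equation [u.1 + w.1 = c.*2.+1] says that [w.1] is the other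
    one; this form is symmetric and suits [lia]. *)
Lemma joinedP u w :
  reflect (exists c, [/\ (u.1 = c :> nat) \/ (u.1 = c.+1 :> nat),
      vertical x c u.2 -> w = (u.1, strip_at c u.2)
    & ~~ vertical x c u.2 -> w.2 = u.2 /\ (u.1 + w.1 = c.*2.+1)%N])
  (joined x u w).
Proof.
apply: (iffP existsP) => -[c cP]; exists c; move: cP; case: (vertical x c u.2) => /=.
- case: w => k h /= /and3P[/eqP-> /eqP-> uc]; split=> //.
  by case/orP: uc => /eqP; [left|right].
- case/andP=> /eqP-> /orP[/andP[/eqP-> /eqP->]|/andP[/eqP-> /eqP->]].
  + by split=> //; [left | split=> //; lia].
  + by split=> //; [right | split=> //; lia].
- case=> uc /(_ isT)-> _ /=; rewrite !eqxx /=.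
  by case: uc => ->; rewrite eqxx ?orbT.
- case=> uc _ /(_ isT)[-> uw]; rewrite eqxx /=.
  by case: uc => uc; apply/orP; [left|right]; lia.
Qed.

Lemma joined_sym : ssrbool.symmetric (joined x).
Proof.
suff S u w : joined x u w -> joined x w u by move=> u w; apply/idP/idP; apply: S.
case/joinedP=> c [uc V H]; apply/joinedP; exists c.
have [v|v] := boolP (vertical x c u.2).
  rewrite (V v) /= vertical_strip v; split=> // _.
  by rewrite strip_atK //; case: (u).
by case: (H v) => -> uw; rewrite (negPf v); split=> //; [lia|split=> //; lia].
Qed.

(** A node borders at most two strips, and each of them joins it to a single node. *)
Lemma joined_deg2 u w1 w2 w3 :
  joined x u w1 -> joined x u w2 -> joined x u w3 -> [\/ w1 = w2, w1 = w3 | w2 = w3].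
Proof.
have det c w w' : 
  (vertical x c u.2 -> w = (u.1, strip_at c u.2)) -> 
  (~~ vertical x c u.2 -> w.2 = u.2 /\ (u.1 + w.1 = c.*2.+1)%N) ->
  (vertical x c u.2 -> w' = (u.1, strip_at c u.2)) -> 
  (~~ vertical x c u.2 -> w'.2 = u.2 /\ (u.1 + w'.1 = c.*2.+1)%N) -> w = w'.
  case: (vertical _ _ _) => [/(_ isT)-> _ /(_ isT)-> //|_ /(_ isT) + _ /(_ isT)].
  case: w w' => [k h] [k' h'] /= [-> e1] [-> e2]; congr (_, _); apply: val_inj => /=; lia.
case/joinedP=> c1 [uc1 V1 H1] /joinedP[c2 [uc2 V2 H2]] /joinedP[c3 [uc3 V3 H3]].
have [/val_inj E|/eqP n12] := eqVneq (c1 : nat) c2.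
  by subst c2; apply: Or31; apply: (det c1).
have [/val_inj E|/eqP n13] := eqVneq (c1 : nat) c3.
  by subst c3; apply: Or32; apply: (det c1).
have /val_inj E : (c2 : nat) = c3 by lia.
by subst c3; apply: Or33; apply: (det c2).
Qed.

(** A node on a side of the rectangle borders only one strip. *)
Lemma joined_end p : terminal (joined x) (end_node ss p).
Proof.
move=> w1 w2 /joinedP[c [uc V H]] /joinedP[c' [uc' V' H']].
have /val_inj E : (c : nat) = c'.
  move: uc uc'; case: p {V H V' H'} => i /=; have := ltn_ord c; have := ltn_ord c'; lia.
subst c'; have [v|v] := boolP (vertical x c (end_node ss p).2); first by rewrite (V v) (V' v).
have [e1 e2] := H v; have [e1' e2'] := H' v.
case: w1 w2 e1 e2 e1' e2' {V H V' H'} => [k h] [k' h'] /= -> e1 -> e2.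
congr (_, _); apply: val_inj => /=; lia.
Qed.

Lemma joined_mirror u w : joined x (mirror_node u) (mirror_node w) = joined x u w.
Proof.
suff S u' w' : joined x u' w' -> joined x (mirror_node u') (mirror_node w').
  by apply/idP/idP=> /S; rewrite ?mirror_nodeK.
case/joinedP=> c [uc V H]; apply/joinedP; exists (rev_ord c).
rewrite /= vertical_rev strip_at_rev //.
have := ltn_ord c; have := ltn_ord u'.1; have := ltn_ord w'.1.
split; [lia | by move/V=> -> | by move/H=> [-> ?]; split=> //; lia].
Qed.

Lemma connect_mirror u w :
  connect (joined x) (mirror_node u) (mirror_node w) = connect (joined x) u w.
Proof.
suff S u' w' : connect (joined x) u' w' -> connect (joined x) (mirror_node u') (mirror_node w').
  by apply/idP/idP=> /S; rewrite ?mirror_nodeK.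
case/connectP=> p pp ->; elim: p u' pp => [|a p IH] u' /=; first by [].
by case/andP=> ea /IH; apply: connect_trans; apply: connect1; rewrite joined_mirror.
Qed.

Lemma connected_sym : connect_sym (joined x).
Proof. exact/sym_connect_sym/joined_sym. Qed.

End State.
End States.

(** * State diagrams are symmetric TL-diagrams *)

Section StateDiagram.
Variables (N : nat) (ss : seq (strip N)).
Hypotheses (ss_strip : all (@is_strip N) ss) (ss_rev : rev ss = ss) (ss_gt0 : (0 < size ss)%N).
Local Notation node := ('I_(size ss).+1 * 'I_N)%type.
Local Notation place := ('I_(size ss) * 'I_N)%type.
Implicit Types (c : 'I_(size ss)) (h i : 'I_N) (u w : node) (p q r : point N).
Local Notation end_node := (@end_node N ss).

Lemma end_node_inj : injective end_node.
Proof.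
case=> i [] j [] //= => [->//|/esym E _|E _|->//]; move: ss_gt0; lia.
Qed.

Lemma end_node_mirror p : end_node (mirror p) = mirror_node (end_node p).
Proof.
by case: p => i; rewrite /mirror_node /=; congr (_, _); apply: val_inj => /=; lia.
Qed.

Variable x : {set place}.
Hypothesis xS : x \in states ss.

Section ClosedSet.
Variable C : {set node}.
Hypothesis C_closed : forall u w, joined x u w -> (u \in C) = (w \in C).

(* Along a strand avoiding C the number of nodes of C above it is constant
   modulo 2; this is what makes state diagrams noncrossing. *)
Definition above (k : 'I_(size ss).+1) (g : nat) := [set h : 'I_N | (h < g)%N && ((k, h) \in C)].

(** Across strip [c], membership in C is carried over unchanged at the heights without vertical
    uncrossing. The vertically uncrossed heights meet C in adjacent pairs, and the hypothesis on [g]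
    says that no such pair is separated by [g]. *)
Let above_step c g (k k' : 'I_(size ss).+1) : k = c :> nat -> k' = c.+1 :> nat ->
    (forall h, vertical x c h -> (h < g)%N = (strip_at c h < g)%N) ->
  odd #|above k g| = odd #|above k' g|.
Proof.
move=> kc kc' gP; pose V := [set h | vertical x c h].
have even_V (k0 : 'I_(size ss).+1) : k0 = c :> nat \/ k0 = c.+1 :> nat -> odd #|above k0 g :&: V| = false.
  move=> k0c; apply: (odd_card_fpf (f := @strip_at N ss c)) => h; rewrite !inE /=.
  - case/andP=> /andP[hg hC] hV; rewrite -gP // hg vertical_strip // hV andbT /=.
    rewrite -(C_closed (u := (k0, h))) //; apply/joinedP => //.
    by exists c => /=; rewrite hV.
  - by move=> _; rewrite strip_atK.
  - by case/andP=> _; apply: vertical_neq.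
have eq_D : above k g :\: V = above k' g :\: V.
  apply/setP => h; rewrite !inE; case hV: (vertical x c h) => //=; congr (_ && _).
  apply: C_closed; apply/joinedP => //; exists c; rewrite /= hV.
  by split=> //; [left | split=> //; lia].
by rewrite -(cardsID V (above k g)) -(cardsID V (above k' g)) eq_D !oddD !even_V; auto.
Qed.

Let odd_level (k k' : 'I_(size ss).+1) : odd #|above k N| = odd #|above k' N|.
Proof.
suff E j (k1 : 'I_(size ss).+1) : k1 = j :> nat -> odd #|above ord0 N| = odd #|above k1 N|.
  by rewrite -(E k k) // (E k' k').
elim: j k1 => [|j IH] k1 kj; first by rewrite (_ : k1 = ord0) //; apply: val_inj.
have lj : (j < size ss)%N by rewrite -ltnS -kj.
rewrite (IH (widen_ord (leqnSn _) (Ordinal lj))) //.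
by apply: (above_step (c := Ordinal lj)) => // h _; rewrite !ltn_ord.
Qed.

(** The number of nodes of C on a vertical line has the same parity on both sides of the rectangle.
    For C a component, this gives every strand starting on the boundary a second end. *)
Lemma card_ends_even : odd #|[set p | end_node p \in C]| = false.
Proof.
have -> : [set p | end_node p \in C] =
    (inl @: above ord0 N) :|: (inr @: above ord_max N).
  apply/setP=> p; rewrite !inE; apply/idP/orP.
    by case: p => i iC; [left|right]; apply: imset_f; rewrite inE ltn_ord.
  by case=> /imsetP[i]; rewrite inE => /andP[_ iC] ->.
rewrite cardsU (_ : _ :&: _ = set0) ?cards0 ?subn0.
  by rewrite oddD !card_imset ?(odd_level ord_max ord0) ?addbb // => ? ? [].
by apply/setP=> p; rewrite !inE; apply/andP=> -[/imsetP[i _ ->] /imsetP[]].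
Qed.

Let above_S k h : (k, h) \notin C -> above k h.+1 = above k h.
Proof.
move=> hC; apply/setP => i; rewrite !inE ltnS leq_eqVlt.
by case: eqP => //= /val_inj ->; rewrite (negPf hC) andbF.
Qed.

(** A vertical uncrossing moves to the adjacent height, and neither node is in C. Otherwise the
    strip is traversed at height [h], and no vertical pair straddles [h], since [h] itself would
    belong to it. *)
Let above_joined u w : joined x u w -> u \notin C ->
  odd #|above u.1 u.2| = odd #|above w.1 w.2|.
Proof.
case: u w => [k h] [k' h'] uw uC; have wC : (k', h') \notin C by rewrite -(C_closed uw).
case/joinedP: (uw) => // c [/= kc V H].
have [v|v] := boolP (vertical x c h).
  have [Ek Eh] := V v; move: wC; rewrite {V H uw}Ek {k'}Eh => wC.
  have ne : strip_at c h <> h :> nat by move/val_inj/eqP; apply/negP/(vertical_neq _ xS).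
  have le := strip_at_le ss_strip c h; have ge := strip_at_ge ss_strip c h.
  have [Eh|Eh] : (h = (strip_at c h).+1 :> nat)%N \/ (strip_at c h = h.+1 :> nat)%N by lia.
    by rewrite Eh above_S.
  by rewrite Eh above_S.
have [-> kk'] := H v.
have hP h0 : vertical x c h0 -> (h0 < h)%N = (strip_at c h0 < h)%N.
  move=> v0; apply/idP/idP => lt.
    rewrite ltn_neqAle (leq_trans (strip_at_le _ _ _)) // andbT.
    by apply: contraNneq v => /val_inj <-; rewrite vertical_strip.
  have := strip_at_ge ss_strip c h0; rewrite leq_eqVlt => /orP[/eqP E|]; last lia.
  rewrite ltn_neqAle E lt andbT -E.
  by apply: contraNneq v => /val_inj <-.
by case: kc => kc; [apply: (above_step (c := c)) | apply/esym/(above_step (c := c))] => //; lia.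
Qed.

Let above_connect u w : connect (joined x) u w -> u \notin C ->
  odd #|above u.1 u.2| = odd #|above w.1 w.2|.
Proof.
case/connectP=> p + ->; elim: p u => [|v p IH] u //= /andP[uv pp] uC.
by rewrite (above_joined uv) // IH // -(C_closed uv).
Qed.

Definition ends_before r := [set p | (end_node p \in C) && (rim p < rim r)%N].

Let ends_before_above r : end_node r \notin C ->
  odd #|ends_before r| = odd #|above (end_node r).1 (end_node r).2|.
Proof.
case: r => i rC /=.
  rewrite -(card_imset (above ord0 i) (@inl_inj 'I_N 'I_N)); congr (odd #|pred_of_set _|).
  apply/setP=> p; rewrite !inE; apply/idP/imsetP => [|[j]]; last first.
    by rewrite inE => /andP[ji jC] ->; rewrite jC.
  case: p => j /= /andP[jC ji]; last by have := ltn_ord i; lia.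
  by exists j; rewrite // inE ji.
(* On the right side the rim is read upwards, so the ends of C that are not before [r] are those
   above it; C having evenly many ends, both counts have the same parity. *)
have := card_ends_even.
rewrite -(cardsID (ends_before (inr i)) [set p | end_node p \in C]).
rewrite (setIidPr _); last by apply/subsetP=> p; rewrite !inE => /andP[].
rewrite oddD => /negbT; rewrite negb_add => /eqP ->.
rewrite -(card_imset (above ord_max i) (@inr_inj 'I_N 'I_N)).
congr (odd #|pred_of_set _|); apply/setP=> p; rewrite !inE; apply/idP/imsetP => [|[j]]; last first.
  by rewrite inE => /andP[ji jC] ->; rewrite jC andbT /=; have := ltn_ord i; lia.
case: p => j /=; case jC : (_ \in C) => //=; rewrite andbT => lt.
  by have := ltn_ord j; lia.
exists j; rewrite // inE jC andbT.
have ne : j <> i :> nat by move/val_inj=> E; move: rC; rewrite -E /= jC.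
by move: lt; have := ltn_ord i; have := ltn_ord j; lia.
Qed.

(** A combinatorial form of the Jordan curve argument: between the two ends of a strand disjoint
    from C there are evenly many ends of C. *)
Lemma ends_before_connect r q : end_node r \notin C ->
  connect (joined x) (end_node r) (end_node q) ->
  odd #|ends_before r| = odd #|ends_before q|.
Proof.
move=> rC rq; rewrite !ends_before_above ?(above_connect rq) //.
case/connectP: rq => p + ->; elim: p (end_node r) rC => //= v p IH u uC /andP[uv].
by apply: IH; rewrite -(C_closed uv).
Qed.

End ClosedSet.
End StateDiagram.

Section StateDiagramTL.
Variables (N : nat) (ss : seq (strip N)).
Hypotheses (ss_strip : all (@is_strip N) ss) (ss_rev : rev ss = ss) (ss_gt0 : (0 < size ss)%N).
Local Notation node := ('I_(size ss).+1 * 'I_N)%type.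
Local Notation place := ('I_(size ss) * 'I_N)%type.
Local Notation end_node := (@end_node N ss).
Variable x : {set place}.
Hypothesis xS : x \in states ss.
Local Notation D := (state_diagram x).
Implicit Types (p q r : point N) (u w : node).

Lemma component_closed v u w : joined x u w -> (u \in component x v) = (w \in component x v).
Proof.
by move=> uw; rewrite !inE; apply/same_connect_r/connect1 => //; apply: connected_sym.
Qed.

Lemma end_unique p q r : connect (joined x) (end_node p) (end_node q) ->
  connect (joined x) (end_node p) (end_node r) -> q != p -> r != p -> q = r.
Proof.
move=> pq pr qp rp; apply: (end_node_inj ss_strip ss_gt0).
apply: (connect_terminals (joined_deg2 ss_strip xS) (joined_sym ss_strip xS) _ _ _ pq pr);
  rewrite ?(inj_eq (end_node_inj ss_strip ss_gt0)) 1?eq_sym //; exact: joined_end.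
Qed.

Lemma state_diagramP p q :
  reflect (q != p /\ connect (joined x) (end_node p) (end_node q)) (D p == q).
Proof.
rewrite ffunE; case: pickP => [r /andP[rp]|none] /=.
  rewrite inE => pr; apply: (iffP eqP) => [<- //|[qp pq]].
  exact: (end_unique pr pq).
(* The default of [state_diagram] never occurs: otherwise [p] would be the only end of its
   component, against parity. *)
have p_in : p \in [set q | end_node q \in component x (end_node p)] by rewrite !inE.
have := card_ends_even ss_strip ss_gt0 xS (@component_closed (end_node p)).
rewrite (cardsD1 p) p_in /= (_ : _ :\ p = set0) ?cards0 //.
by apply/setP=> r; rewrite in_setD1 in_set none in_set0.
Qed.

Lemma state_diagram_connect p : connect (joined x) (end_node p) (end_node (D p)).
Proof. by case: (state_diagramP p (D p) _) => // -[]. Qed.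

Lemma mirrorK : involutive (@mirror N). Proof. by case. Qed.

Lemma state_diagram_symTL : D \in symTL N.
Proof.
have DN p : D p != p by have /state_diagramP[] := eqxx (D p).
have DK p : D (D p) = p.
  apply/eqP/state_diagramP; split; first by rewrite eq_sym.
  by rewrite connected_sym // state_diagram_connect.
rewrite !inE; apply/and3P; split.
- by apply/forallP=> p; rewrite DK DN eqxx.
- apply/forallP=> p; apply/forallP=> q; apply/and3P => -[pq qDp DpDq].
  (* If p < q < D p < D q along the rim, then the component of p has one end before q but two before
     D q, although the strand of q avoids it. *)
  set C := component x (end_node p).
  have CE r : (end_node r \in C) = (r == p) || (r == D p).
    rewrite inE; apply/idP/orP => [pr|[]/eqP-> //]; last exact: state_diagram_connect.
    have [->|rp] := eqVneq r p; [by left | right].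
    by rewrite eq_sym; apply/state_diagramP.
  have qC : end_node q \notin C.
    by rewrite CE; apply/norP; split; apply/eqP=> E; move: pq qDp; rewrite E ltnn.
  have := ends_before_connect ss_strip ss_gt0 xS (@component_closed _) qC (state_diagram_connect q).
  rewrite (_ : ends_before C q = [set p]) ?cards1.
    rewrite (_ : ends_before C (D q) = [set p; D p]) ?cards2 1?eq_sym ?DN //.
    apply/setP=> r; rewrite in_set CE in_set2.
    by case: eqP => [->|_] /=; [lia | case: eqP => [->|]].
  apply/setP=> r; rewrite in_set CE in_set1.
  by case: eqP => [->|_] /=; [lia | case: eqP => [->|//]; lia].
- apply/forallP=> p; apply/state_diagramP; split.
    by rewrite (inj_eq (can_inj mirrorK)) DN.
  by rewrite !end_node_mirror // connect_mirror // state_diagram_connect.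
Qed.

End StateDiagramTL.

(** * Colourings of the strands *)

(** The colour corrected by the parity of the height. A vertical edge of a symmetric TL-diagram
    joins vertices of opposite parity, so equal twists mean that exactly one end is in I; a
    horizontal edge imposes nothing. *)
Definition twist N (I : {set 'I_N}) (i : 'I_N) : bool := (i \in I) (+) odd i.

Definition compatible N (I : {set 'I_N}) (D : diagram N) : bool :=
  [forall p, twist I (label p) == twist I (label (D p))].

Section Colourings.
Variables (N : nat) (ss : seq (strip N)).
Hypotheses (ss_strip : all (@is_strip N) ss) (ss_rev : rev ss = ss) (ss_gt0 : (0 < size ss)%N).
Local Notation node := ('I_(size ss).+1 * 'I_N)%type.
Local Notation place := ('I_(size ss) * 'I_N)%type.
Local Notation end_node := (@end_node N ss).
Variable I : {set 'I_N}.
Implicit Types (x : {set place}) (c g : {set node}) (p q r : point N) (u w : node).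

Definition proper_colouring c :=
  [forall u, (mirror_node u \in c) == (u \in c)] && [forall i, ((ord0, i) \in c) == (i \in I)].

(* The nodes in c are those where the strand is followed from left to right.  As
   a vertical uncrossing joins adjacent heights, following the strands according
   to the parity of the height is always consistent. *)
Definition orients c x :=
  [forall u, forall w, joined x u w ==> ((u \in c) (+) odd u.2 == (w \in c) (+) odd w.2)].

Section State.
Variable x : {set place}.
Hypothesis xS : x \in states ss.

Let invariant g :=
  [/\ forall u w, joined x u w -> (u \in g) = (w \in g),
      forall u, (mirror_node u \in g) = (u \in g)
    & forall i, ((ord0, i) \in g) = twist I i].

(** After this correction, orienting the strands means being a union of components. *)
Let flip c : {set node} := [set u | (u \in c) (+) odd u.2].

Let flipK : involutive flip.
Proof. by move=> c; apply/setP=> u; rewrite !inE addbK. Qed.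

Let invariantP c :
  reflect (invariant (flip c)) (proper_colouring c && orients c x).
Proof.
apply: (iffP andP) => [[/andP[/forallP cm /forallP cI] /forallP co]|[co cm cI]].
  split=> [u w uw|u|i]; rewrite ![in LHS]inE ?[in RHS]inE.
  - by have /forallP/(_ w)/implyP/(_ uw)/eqP := co u.
  - by rewrite (eqP (cm u)).
  - by rewrite (eqP (cI i)).
split; last first.
  by apply/forallP=> u; apply/forallP=> w; apply/implyP=> /co; rewrite !inE => ->.
apply/andP; split; apply/forallP=> u.
  by have := cm u; rewrite !inE /= => /addIb ->.
by have := cI u; rewrite inE /= => /addIb ->.
Qed.

(** A mirror-symmetric union of components is a union of these classes, and the classes away from
    the boundary are what [nb_loops] counts. *)
Let mirror_class u := component x u :|: [set mirror_node w | w in component x u].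
Let loop_classes := [set L :|: [set mirror_node u | u in L] | L : {set node} in loops x].

Let in_mirror_class u w :
  (w \in mirror_class u) = connect (joined x) u w || connect (joined x) u (mirror_node w).
Proof.
rewrite !inE; congr (_ || _); apply/imsetP/idP => [[v]|uw].
  by rewrite inE => uv ->; rewrite mirror_nodeK.
by exists (mirror_node w); rewrite ?inE ?mirror_nodeK.
Qed.

Let touches u := [exists p, end_node p \in component x u].

Let touches_joined u w : joined x u w -> touches u = touches w.
Proof.
move=> uw; apply: eq_existsb => p; rewrite !inE.
by apply: same_connect; [apply: connected_sym | apply: connect1].
Qed.

Let touches_mirror u : touches (mirror_node u) = touches u.
Proof.
apply/existsP/existsP => -[p]; rewrite inE => up; exists (mirror p); rewrite inE.
  by rewrite end_node_mirror // -connect_mirror // mirror_nodeK.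
by rewrite end_node_mirror // connect_mirror.
Qed.

Let loop_classesP u : (mirror_class u \in loop_classes) = ~~ touches u.
Proof.
apply/imsetP/idP => [[L /imsetP[v]]|nt]; last first.
  exists (component x u) => //; apply/imsetP; exists u => //.
  by rewrite inE; apply/forallP=> p; apply: contraNN nt => up; apply/existsP; exists p.
rewrite inE => /forallP vN -> E.
have /eqP {}vN : touches v == false.
  by rewrite eqbF_neg; apply/existsP=> -[p]; apply/negP.
have tconn a b : connect (joined x) a b -> touches a = touches b.
  by case/connectP=> s + ->; elim: s a => //= a' s IH a /andP[/touches_joined-> /IH].
have : u \in mirror_class u by rewrite in_mirror_class connect0.
rewrite E -/(mirror_class v) in_mirror_class => /orP[/tconn <-|/tconn]; rewrite vN //.
by rewrite touches_mirror => <-.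
Qed.

Let mirror_class_joined u w : joined x u w -> mirror_class u = mirror_class w.
Proof.
move=> /connect1/same_connect E; apply/setP => v.
by rewrite !in_mirror_class !E //; apply: connected_sym.
Qed.

Let mirror_class_mirror u : mirror_class (mirror_node u) = mirror_class u.
Proof.
apply/setP => v; rewrite !in_mirror_class orbC connect_mirror //; congr (_ || _).
by rewrite -connect_mirror // mirror_nodeK.
Qed.

Let invariant_class g u w : invariant g -> w \in mirror_class u -> (w \in g) = (u \in g).
Proof.
case=> gj gm _; have gconn a b : connect (joined x) a b -> (a \in g) = (b \in g).
  by case/connectP=> s + ->; elim: s a => //= a' s IH a /andP[/gj-> /IH].
by rewrite in_mirror_class => /orP[] /gconn ->; rewrite ?gm.
Qed.

Let invariant_end g p : invariant g -> (end_node p \in g) = twist I (label p).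
Proof.
case=> _ gm gI; case: p => i; first exact: gI.
by rewrite -[inr i]/(mirror (inl i)) end_node_mirror // gm gI.
Qed.

Let end_twist u p q : compatible I (state_diagram x) ->
  end_node p \in component x u -> end_node q \in component x u ->
  twist I (label p) = twist I (label q).
Proof.
move=> /forallP/(_ p)/eqP pD; rewrite !inE => up uq.
have [-> //|qp] := eqVneq q p; rewrite pD; congr (twist I (label _)).
apply/eqP/state_diagramP => //; split=> //.
by rewrite (connect_trans _ uq) // connected_sym.
Qed.

(** On strands that reach the boundary the value is forced by I; only the loop classes leave a
    choice, recorded by [S]. *)
Let fill (S : {set {set node}}) : {set node} :=
  [set u | if touches u then [exists p, (end_node p \in component x u) && twist I (label p)]
           else mirror_class u \in S].

Let fill_invariant S : compatible I (state_diagram x) -> invariant (fill S).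
Proof.
move=> comp; have tw u p : end_node p \in component x u -> (u \in fill S) = twist I (label p).
  move=> up; have tu : touches u by apply/existsP; exists p.
  rewrite inE tu; apply/existsP/idP => [[q /andP[uq]]|tp].
    by rewrite (end_twist (p := p) (q := q) comp up uq).
  by exists p; rewrite up.
split=> [u w uw|u|i].
- have := touches_joined uw; rewrite /fill !inE => <-; case: (touches u).
    by apply: eq_existsb=> p; rewrite !inE (same_connect _ (connect1 uw)) //; apply: connected_sym.
  by rewrite (mirror_class_joined uw).
- have [/existsP[p up]|nt] := boolP (touches u); last first.
    by rewrite !inE touches_mirror (negPf nt) mirror_class_mirror.
  rewrite (tw _ _ up) (tw _ (mirror p)); first by case: (p).
  by rewrite inE end_node_mirror // connect_mirror //; rewrite inE in up.
- by rewrite (tw _ (inl i)) // inE.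
Qed.

(** The end colours dictate the direction of each strand with ends, consistently exactly when the
    diagram is compatible; a loop, together with its mirror image, can be followed in two ways. This
    is the meaning of the factor 2^l in the weight. *)
Lemma card_orientations :
  #|[set c | proper_colouring c && orients c x]| =
  (if compatible I (state_diagram x) then 2 ^ nb_loops x else 0)%N.
Proof.
case: ifPn => comp; last first.
  apply: eq_card0 => c; rewrite inE; apply/invariantP => ci; case/negP: comp.
  apply/forallP=> p; rewrite -!(invariant_end _ ci); apply/eqP/esym.
  by apply: (invariant_class ci); rewrite in_mirror_class state_diagram_connect.
rewrite -/loop_classes -[nb_loops x]/(#|loop_classes|) -card_powerset.
rewrite -(card_imset _ (can_inj flipK)).
rewrite -[RHS](card_in_imset (f := fill)); last first.
  move=> S1 S2; rewrite !inE => sS1 sS2 E.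
  suff H B : B \in loop_classes -> (B \in S1) = (B \in S2).
    apply/setP=> B; have [/H //|nB] := boolP (B \in loop_classes).
    by apply/idP/idP=> [/(subsetP sS1)|/(subsetP sS2)]; rewrite (negPf nB).
  move=> BL; have /imsetP[L /imsetP[u _ EL] EB] := BL.
  have {L EL}EB : B = mirror_class u by rewrite EB EL.
  have := BL; rewrite EB loop_classesP => nt.
  by move/setP/(_ u): E; rewrite !inE (negPf nt).
congr #|pred_of_set _|; apply/setP=> g; apply/imsetP/imsetP => [[c]|[S]].
  rewrite inE => /invariantP ci ->.
  exists [set B in loop_classes | B \subset flip c].
    by rewrite inE; apply/subsetP=> B; rewrite inE => /andP[].
  apply/setP=> u; rewrite [RHS]inE; case: ifPn => [/existsP[p up]|nt].
    rewrite -(invariant_class (w := end_node p) ci); last first.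
      by rewrite in_mirror_class; rewrite inE in up; rewrite up.
    rewrite (invariant_end _ ci); apply/idP/existsP => [tp|[q /andP[uq tq]]].
      by exists p; rewrite up.
    by rewrite (end_twist (p := p) (q := q) comp up uq).
  rewrite [RHS]inE loop_classesP nt; apply/idP/subsetP => [uc w wu|->//].
    by rewrite (invariant_class ci wu).
  by rewrite in_mirror_class connect0.
rewrite inE => _ ->; exists (flip (fill S)); last by rewrite flipK.
by rewrite inE; apply/invariantP; rewrite flipK; apply: fill_invariant.
Qed.

End State.
End Colourings.

(** * Summing over the states of a matching *)

Definition respects N (pi : {ffun 'I_N -> 'I_N}) (I : {set 'I_N}) : bool :=
  [forall e, (pi e \in I) == (e \in I)].

Section Sides.
Variable m : nat.
Implicit Types k : 'I_m.

Definition before k : 'I_m.+1 := widen_ord (leqnSn _) k.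
Definition after k : 'I_m.+1 := lift ord0 k.

Lemma before_rev k : before (rev_ord k) = rev_ord (after k).
Proof. by apply: val_inj; rewrite /= /bump /=; lia. Qed.

Lemma after_rev k : after (rev_ord k) = rev_ord (before k).
Proof. by apply: val_inj; rewrite /= /bump /=; have := ltn_ord k; lia. Qed.

End Sides.

Section StateSum.
Import GRing.Theory.
Local Open Scope ring_scope.
Variables (N : nat) (ss : seq (strip N)) (pi : {ffun 'I_N -> 'I_N}).
Hypotheses (N_gt0 : (0 < N)%N) (pi_match : pi \in matchings 'I_N).
Hypothesis nice : nice_embedding ss pi.
Local Notation node := ('I_(size ss).+1 * 'I_N)%type.
Local Notation place := ('I_(size ss) * 'I_N)%type.
Variable I : {set 'I_N}.
Implicit Types (x : {set place}) (c : {set node}) (k : 'I_(size ss)) (h e f : 'I_N).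
Implicit Types (y : place).

Let ss_strip : all (@is_strip N) ss. Proof. by case: nice. Qed.
Let ss_rev : rev ss = ss. Proof. by case: nice. Qed.

Lemma height_end e : height ss (size ss) e = pi e.
Proof. by case: nice => _ _ /(_ e) + _; rewrite ffunE => -[<-]. Qed.

Lemma matchK : involutive pi.
Proof. by move=> e; move: pi_match; rewrite inE => /forallP/(_ e)/andP[/eqP]. Qed.

Lemma match_neq e : pi e != e.
Proof. by move: pi_match; rewrite inE => /forallP/(_ e)/andP[]. Qed.

Lemma nice_size_gt0 : (0 < size ss)%N.
Proof.
case: posnP => // s0; have := match_neq (Ordinal N_gt0).
by rewrite -height_end s0 height0 eqxx.
Qed.

Lemma height_match e (k : nat) : (k <= size ss)%N -> height ss (size ss - k) (pi e) = height ss k e.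
Proof.
move=> lk; rewrite -height_end height_rev //.
by move=> f; rewrite !height_end matchK.
Qed.

(** The colours around [y] allow its vertical ([b] true) or horizontal uncrossing: a strand turning
    back has opposite colours at its two nodes, a strand passing through has equal ones. *)
Definition admits c y (b : bool) :=
  if b then (((before y.1, y.2) \in c) != ((before y.1, strip_at y.1 y.2) \in c)) &&
            (((after y.1, y.2) \in c) != ((after y.1, strip_at y.1 y.2) \in c))
  else (((before y.1, y.2) \in c) == ((after y.1, y.2) \in c)) &&
       (((before y.1, strip_at y.1 y.2) \in c) == ((after y.1, strip_at y.1 y.2) \in c)).

Section OneState.
Variable x : {set place}.
Hypothesis xS : x \in states ss.

Lemma vertical_crossing y : y \in crossings ss -> vertical x y.1 y.2 = (y \in x).
Proof.
case: y => k h; rewrite inE /= => lt; rewrite /vertical.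
suff /negPf -> : (k, strip_at k h) \notin x by rewrite orbF.
by apply/negP=> /(subsetP (state_sub xS)); rewrite inE /= strip_atK //; lia.
Qed.

(** Being oriented is a local condition at each strip. The parities in [orients] drop out because
    the two heights of a crossing differ by one. *)
Lemma orientsP c :
  reflect ((forall y, y \in crossings ss -> admits c y (y \in x)) /\
           (forall k h, strip_at k h = h -> ((before k, h) \in c) = ((after k, h) \in c)))
          (orients c x).
Proof.
apply: (iffP forallP) => [co|[cy cf] u].
  have {}co u w : joined x u w -> (u \in c) (+) odd u.2 = (w \in c) (+) odd w.2.
    by move: (co u) => /forallP/(_ w)/implyP uw /uw/eqP.
  split=> [y yC|k h hk].
    have := yC; rewrite inE => lt.
    have odd_s : odd (strip_at y.1 y.2) = ~~ odd y.2.
      by have := strip_at_le ss_strip y.1 y.2; move: lt; lia.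
    have v := vertical_crossing yC; have v' := v; rewrite -(vertical_strip ss_strip) in v'.
    rewrite /admits; case: (y \in x) v v' => v v'.
      have J (a : 'I_(size ss).+1) : a = y.1 :> nat \/ a = y.1.+1 :> nat ->
          joined x (a, y.2) (a, strip_at y.1 y.2).
        by move=> ay; apply/joinedP => //; exists y.1; rewrite /= v.
      have := co _ _ (J (before y.1) _); have := co _ _ (J (after y.1) _); rewrite /= odd_s.
      move=> /(_ (or_intror erefl)) + /(_ (or_introl erefl)).
      by case: (_ \in c); case: (_ \in c); case: odd => //; case: (_ \in c); case: (_ \in c).
    have J h : ~~ vertical x y.1 h -> joined x (before y.1, h) (after y.1, h).
      move=> nv; apply/joinedP => //; exists y.1; rewrite /= (negPf nv).
      by split=> //; [left | split=> //=; rewrite /bump /=; lia].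
    have := co _ _ (J y.2 (negbT v)); have := co _ _ (J _ (negbT v')).
    by move=> /addIb -> /addIb ->; rewrite !eqxx.
  suff /co/addIb : joined x (before k, h) (after k, h) by [].
  apply/joinedP => //; exists k.
  have nv : ~~ vertical x k h by apply/negP=> /(vertical_neq ss_strip xS); rewrite hk eqxx.
  by rewrite /= (negPf nv); split=> //; [left | split=> //=; rewrite /bump /=; lia].
apply/forallP=> w; apply/implyP=> /joinedP[]// k [uk V H]; apply/eqP.
have uba : u.1 = before k \/ u.1 = after k.
  by case: uk => uk; [left|right]; apply: val_inj; rewrite /= ?/bump.
have [v|nv] := boolP (vertical x k u.2).
  rewrite (V v) {V H} /=; case: u uba v {uk} => a h /= aE v.
  wlog lt : h v / (h < strip_at k h)%N => [hw|].
    have := vertical_neq ss_strip xS v; rewrite neq_ltn => /orP[lt|]; last exact: hw.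
    have := hw (strip_at k h); rewrite vertical_strip // strip_atK //.
    by move=> /(_ v lt) ->.
  have yC : (k, h) \in crossings ss by rewrite inE.
  have yx : (k, h) \in x by rewrite -vertical_crossing.
  have odd_s : odd (strip_at k h) = ~~ odd h.
    by have := strip_at_le ss_strip k h; lia.
  have := cy _ yC; rewrite yx /admits odd_s /= => /andP[].
  have neqN (a1 a2 : bool) : a1 != a2 -> forall o, a1 (+) o = a2 (+) ~~ o by case: a1 a2 => [] [] // _ [].
  by case: aE => -> n1 n2; apply: neqN.
have [Ew uw] := H nv; rewrite Ew; congr (_ (+) _).
suff E : ((before k, u.2) \in c) = ((after k, u.2) \in c).
  case: u w uba Ew uw {uk V H} nv E => a h [b h'] /= [] -> -> bE nv E.
    suff -> : b = after k by []. by apply: val_inj; move: bE; rewrite /= /bump /=; lia.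
  suff -> : b = before k by []. by apply: val_inj; move: bE; rewrite /= /bump /=; lia.
have [sE|ne] := eqVneq (strip_at k u.2) u.2; first exact: cf.
move: ne; rewrite neq_ltn => /orP[lt|lt].
  have yC : (k, strip_at k u.2) \in crossings ss by rewrite inE /= strip_atK.
  have := cy _ yC; rewrite -(vertical_crossing yC) /= vertical_strip // (negPf nv).
  by rewrite /admits /= strip_atK // => /andP[_ /eqP].
have yC : (k, u.2) \in crossings ss by rewrite inE.
have := cy _ yC; rewrite -(vertical_crossing yC) /= (negPf nv).
by rewrite /admits /= => /andP[/eqP].
Qed.

End OneState.
End StateSum.

(** * Signs of states and the toggling of an uncrossing *)

Section Exchange.
Import GRing.Theory.
Local Open Scope ring_scope.
Variables (N : nat) (ss : seq (strip N)) (pi : {ffun 'I_N -> 'I_N}).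
Hypotheses (N_gt0 : (0 < N)%N) (pi_match : pi \in matchings 'I_N).
Hypothesis nice : nice_embedding ss pi.
Local Notation node := ('I_(size ss).+1 * 'I_N)%type.
Local Notation place := ('I_(size ss) * 'I_N)%type.
Variable I : {set 'I_N}.
Implicit Types (x : {set place}) (c : {set node}) (k : 'I_(size ss)) (h e f : 'I_N).
Implicit Types (y : place).

Let ss_strip : all (@is_strip N) ss. Proof. by case: nice. Qed.
Let ss_rev : rev ss = ss. Proof. by case: nice. Qed.
Let piK : involutive pi. Proof. exact: matchK. Qed.

Lemma meet_once e f k k' : e != f ->
  strip_at k (height ss k e) = height ss k f ->
  strip_at k' (height ss k' e) = height ss k' f -> k = k'.
Proof.
move=> ef m1 m2; case: nice => _ _ _ /(_ e f ef) /card_le1_eqP; apply; rewrite inE; exact/eqP.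
Qed.

Lemma height_onto k h : exists e, height ss k e = h.
Proof.
have inj : injective (height ss k) by apply: height_inj => //; apply: ltnW.
by exists (invF inj h); rewrite f_invF.
Qed.

(** The reflection sends a crossing of an edge with its mirror image to a crossing of the same two
    edges, which meet only once; so it lies on the axis. Conversely, in the middle strip the mirror
    image of the edge leaving at some height enters at that height. *)
Lemma unpairedP y : y \in crossings ss -> (y \in unpaired ss pi) = (mirror_crossing y == y).
Proof.
case: y => k h yC; have lt : (h < strip_at k h)%N by rewrite inE in yC.
have [e eh] := height_onto k h; have [f fh] := height_onto k (strip_at k h).
have ef : e != f.
  by apply/eqP=> E; move: eh lt; rewrite E fh => ->; rewrite ltnn.
have mir e0 : height ss (rev_ord k).+1 (pi e0) = height ss k e0.
  rewrite -(@height_match _ _ _ pi_match nice e0 k) ?(ltnW (ltn_ord k)) //.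
  by congr height; rewrite /=; have := ltn_ord k; lia.
have mir' e0 : height ss (rev_ord k) (pi e0) = height ss k.+1 e0.
  by rewrite -(@height_match _ _ _ pi_match nice e0 k.+1) ?ltn_ord.
rewrite inE yC /=; apply/existsP/eqP => [[e' /andP[/eqP e'h /eqP pe']]|[rk]].
  have {e'h}ee : e' = e by apply: (@height_inj _ ss ss_strip k); rewrite ?e'h ?(ltnW (ltn_ord k)).
  have fe : f = pi e.
    apply: (@height_inj _ ss ss_strip k); first exact: ltnW.
    by rewrite fh -ee pe'.
  congr (_, _); apply: (@meet_once e f) => //; last by rewrite eh fh.
  rewrite fe mir' heightS eh strip_at_rev //.
  have -> : e = pi f by rewrite fe piK.
  by rewrite mir' heightS fh strip_atK // strip_atK.
exists e; rewrite eh eqxx /=; have := mir' e; rewrite rk heightS eh => ->.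
exact: eqxx.
Qed.

Definition state_sign x : int := (-1) ^+ (uv pi x + ph pi x).

Lemma card_paired x : x \in states ss -> ((ph pi x).*2 = #|paired ss pi :\: x|)%N.
Proof.
move=> xS; apply: card_orbit_pairs => y; rewrite !in_setD.
- case/and3P=> yx yu yC; rewrite state_mirror // yx mirror_crossing_in // yC andbT /=.
  rewrite unpairedP ?mirror_crossing_in // mirror_crossingK eq_sym -unpairedP //.
- by rewrite mirror_crossingK.
- by case/and3P=> yx yu yC; rewrite -unpairedP.
Qed.

Definition toggle y x : {set place} := [set z | (z \in x) (+) (z \in [set y; mirror_crossing y])].

Lemma toggleK y : involutive (toggle y).
Proof. by move=> x; apply/setP=> z; rewrite !inE addbK. Qed.

Lemma toggle_states y x : y \in crossings ss -> (toggle y x \in states ss) = (x \in states ss).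
Proof.
move=> yC; suff S x' : x' \in states ss -> toggle y x' \in states ss.
  by apply/idP/idP=> /S; rewrite ?toggleK.
move=> xS; rewrite inE; apply/andP; split.
  apply/subsetP=> z; rewrite inE; case: (boolP (z \in x')) => [/(subsetP (state_sub xS)) //|_].
  by rewrite in_set2 => /orP[]/eqP-> //; rewrite mirror_crossing_in.
apply/forallP=> z; apply/implyP=> zC; rewrite !inE state_mirror //.
rewrite (can2_eq (@mirror_crossingK _ _) (@mirror_crossingK _ _)).
by rewrite (inj_eq (can_inj (@mirror_crossingK _ _))) [X in _ (+) X]orbC.
Qed.

(** An unpaired crossing is its own mirror image and changes [uv] by one; a paired one is toggled
    along with its mirror image, and this changes [ph] by one. *)
Let sign_toggle_notin y x : y \in crossings ss -> x \in states ss -> y \notin x ->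
  state_sign (toggle y x) = - state_sign x.
Proof.
move=> yC xS yx; have tS : toggle y x \in states ss by rewrite toggle_states.
have yx' : mirror_crossing y \notin x by rewrite state_mirror.
have tE z : (z \in toggle y x) = (z \in x) || (z \in [set y; mirror_crossing y]).
  by rewrite in_set in_set2; do 2?case: eqP => [->|_]; rewrite ?(negPf yx) ?(negPf yx') ?addbF ?orbF ?orbT.
rewrite /state_sign; have [yu|yp] := boolP (y \in unpaired ss pi).
  have yy : mirror_crossing y = y by apply/eqP; rewrite -unpairedP.
  have -> : ph pi (toggle y x) = ph pi x.
    apply: double_inj; rewrite !card_paired //; congr #|pred_of_set _|.
    apply/setP=> z; rewrite !in_setD tE in_set2 yy orbb.
    by case: eqP => [->|_]; rewrite ?orbF // orbT (negPf yx) yu.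
  have -> : uv pi (toggle y x) = (uv pi x).+1.
    rewrite /uv (_ : _ :&: _ = y |: (unpaired ss pi :&: x)).
      by rewrite cardsU1 in_setI (negPf yx) andbF.
    apply/setP=> z; rewrite in_setU1 !in_setI tE in_set2 yy orbb.
    by case: eqP => [->|_]; rewrite ?yu ?orbT ?orbF.
  by rewrite addSn exprS mulN1r.
have yN : mirror_crossing y != y by rewrite -unpairedP.
have y'p : mirror_crossing y \notin unpaired ss pi.
  by rewrite unpairedP ?mirror_crossing_in // mirror_crossingK eq_sym.
have -> : uv pi (toggle y x) = uv pi x.
  congr #|pred_of_set _|; apply/setP=> z; rewrite !in_setI tE in_set2.
  case: eqP => [->|_]; first by rewrite (negPf yp).
  by case: eqP => [->|_]; rewrite ?(negPf y'p) ?orbF.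
have -> : ph pi x = (ph pi (toggle y x)).+1.
  apply: double_inj; rewrite doubleS !card_paired //.
  rewrite (_ : _ :\: x = y |: (mirror_crossing y |: (paired ss pi :\: toggle y x))).
    rewrite !cardsU1 in_setU1 !in_setD !tE set21 set22 !orbT /= orbF eq_sym (negPf yN).
    by [].
  apply/setP=> z; rewrite !in_setU1 !in_setD tE in_set2.
  case: eqP => [->|_]; first by rewrite yx yp yC.
  by case: eqP => [->|_]; rewrite ?yx' ?y'p ?mirror_crossing_in ?yC ?orbF.
by rewrite addnS exprS mulN1r opprK.
Qed.

Lemma sign_toggle y x : y \in crossings ss -> x \in states ss ->
  state_sign (toggle y x) = - state_sign x.
Proof.
move=> yC xS; have [yx|] := boolP (y \in x); last exact: sign_toggle_notin.
rewrite -{2}(toggleK y x) (@sign_toggle_notin y (toggle y x)) ?opprK ?toggle_states //.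
by rewrite /toggle in_set yx set21.
Qed.

End Exchange.

Section WireColouring.
Import GRing.Theory.
Local Open Scope ring_scope.
Variables (N : nat) (ss : seq (strip N)) (pi : {ffun 'I_N -> 'I_N}).
Hypotheses (N_gt0 : (0 < N)%N) (pi_match : pi \in matchings 'I_N).
Hypothesis nice : nice_embedding ss pi.
Local Notation node := ('I_(size ss).+1 * 'I_N)%type.
Local Notation place := ('I_(size ss) * 'I_N)%type.
Variable I : {set 'I_N}.
Implicit Types (x : {set place}) (c : {set node}) (k : 'I_(size ss)) (h e f : 'I_N).
Implicit Types (y : place).

Let ss_strip : all (@is_strip N) ss. Proof. by case: nice. Qed.
Let ss_rev : rev ss = ss. Proof. by case: nice. Qed.
Let ss_gt0 : (0 < size ss)%N. Proof. exact: (nice_size_gt0 N_gt0 pi_match nice). Qed.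

Let toggleS := toggle_states nice.

Let admits_mirror c y b : proper_colouring I c -> admits c (mirror_crossing y) b = admits c y b.
Proof.
case/andP=> /forallP cm _; case: y => k h.
have cm1 h0 : ((after (rev_ord k), h0) \in c) = ((before k, h0) \in c).
  by rewrite after_rev -(eqP (cm (before k, h0))).
have cm2 h0 : ((before (rev_ord k), h0) \in c) = ((after k, h0) \in c).
  by rewrite before_rev -(eqP (cm (after k, h0))).
rewrite /admits /= !cm1 !cm2 strip_at_rev //; case: b; first exact: andbC.
by congr (_ && _); apply: eq_sym.
Qed.

Definition colouring_sum c : int :=
  \sum_(x : {set place} | (x \in states ss) && orients c x) state_sign pi x.

(** Toggling [y] is a sign-reversing involution on the states oriented by [c]. *)
Let colouring_sum_free c y : proper_colouring I c -> y \in crossings ss ->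
  admits c y true -> admits c y false -> colouring_sum c = 0.
Proof.
move=> cP yC y1 y0; pose t := @toggle _ ss y.
have orients_toggle x : x \in states ss -> orients c x -> orients c (t x).
  move=> xS /(orientsP N_gt0 pi_match nice xS)[cy cf].
  apply/(orientsP N_gt0 pi_match nice); first by rewrite toggleS //.
  split=> // z zC; rewrite /t /toggle in_set; have := cy z zC.
  rewrite in_set2; case: eqP => [->|_]; first by case: (_ (+) _).
  case: eqP => [->|_]; last by rewrite addbF.
  by rewrite !admits_mirror //; case: (_ (+) _).
have tP x : (t x \in states ss) && orients c (t x) = (x \in states ss) && orients c x.
  rewrite toggleS //; apply/andP/andP=> -[xS co]; split=> //.
    by rewrite -(toggleK y x); apply: orients_toggle; rewrite ?toggleS.
  exact: orients_toggle.
have : colouring_sum c = - colouring_sum c.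
  rewrite {1}/colouring_sum (reindex_inj (can_inj (@toggleK _ ss y))) (eq_bigl _ _ tP) /=.
  by rewrite -sumrN; apply: eq_bigr => x /andP[xS _]; apply: sign_toggle.
by lia.
Qed.

Let wire_colour c (a : 'I_(size ss).+1) e :
    (forall k h, ((before k, h) \in c) = ((after k, strip_at k h) \in c)) ->
    (forall i, ((ord0, i) \in c) = (i \in I)) ->
  ((a, height ss a e) \in c) = (e \in I).
Proof.
move=> cw cI; suff E j (b : 'I_(size ss).+1) : b = j :> nat -> ((b, height ss b e) \in c) = (e \in I).
  exact: E.
elim: j b => [|j IH] b bj.
  by rewrite bj height0 -cI (_ : b = ord0) //; apply: val_inj.
have lj : (j < size ss)%N by rewrite -ltnS -bj.
rewrite bj (heightS (Ordinal lj)) (_ : b = after (Ordinal lj)); last exact: val_inj.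
by rewrite -cw -(IH (before (Ordinal lj))).
Qed.

Definition wire_colouring : {set node} :=
  [set u : node | [exists e in I, height ss u.1 e == u.2]].

Lemma in_wire_colouring (a : 'I_(size ss).+1) e :
  ((a, height ss a e) \in wire_colouring) = (e \in I).
Proof.
rewrite inE /=; apply/existsP/idP => [[f /andP[fI /eqP]]|eI]; last by exists e; rewrite eI /=.
by move/height_inj => <- //; rewrite -ltnS ltn_ord.
Qed.

(** When no crossing is free, each one admits exactly one of the two uncrossings, and then the four
    colours around it follow the two edges through it. *)
Let colouring_sum_wire c : proper_colouring I c -> colouring_sum c <> 0 -> c = wire_colouring.
Proof.
move=> cP cN; have /existsP[x /andP[xS co]] : [exists x, (x \in states ss) && orients c x].
  apply: contraT => /existsPn none; case: cN.
  by apply: big_pred0 => x; apply/negbTE.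
have free y : y \in crossings ss -> admits c y true -> admits c y false -> False.
  by move=> yC y1 y0; apply: cN; apply: (colouring_sum_free cP yC).
have [cy cf] := orientsP N_gt0 pi_match nice xS c co.
have step y : y \in crossings ss ->
    ((before y.1, y.2) \in c) = ((after y.1, strip_at y.1 y.2) \in c) /\
    ((before y.1, strip_at y.1 y.2) \in c) = ((after y.1, y.2) \in c).
  move=> yC; move: (cy y yC) (free y yC); rewrite /admits.
  by case: (y \in x); do 4 case: (_ \in c) => //=; move=> _ F; exfalso; apply: F.
apply/setP=> -[a h]; have la : (a <= size ss)%N by rewrite -ltnS.
have [e <-] : exists e, height ss a e = h.
  by exists (invF (height_inj ss_strip la) h); rewrite f_invF.
rewrite in_wire_colouring; apply: wire_colour => [k h0|i]; last first.
  by case/andP: cP => _ /forallP/(_ i)/eqP.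
have [sE|ne] := eqVneq (strip_at k h0) h0; first by rewrite sE cf.
move: ne; rewrite neq_ltn => /orP[lt|lt].
  have yC : (k, strip_at k h0) \in crossings ss by rewrite inE /= strip_atK.
  by have [_] := step _ yC; rewrite /= strip_atK.
have yC : (k, h0) \in crossings ss by rewrite inE.
by have [] := step _ yC.
Qed.

(** The mirror image of the edge starting at [e] is the edge starting at [pi e]; symmetry of the
    colouring means that they have the same colour. *)
Lemma wire_respects : proper_colouring I wire_colouring = respects pi I.
Proof.
have mir (a : 'I_(size ss).+1) e :
    mirror_node (a, height ss a e) = (rev_ord a, height ss (rev_ord a) (pi e)).
  rewrite /mirror_node /=; congr (_, _); rewrite subSS.
  by rewrite (@height_match _ _ _ pi_match nice) // -ltnS.
have atI i : ((ord0, i) \in wire_colouring) = (i \in I).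
  by rewrite -[in LHS](height0 ss i) in_wire_colouring.
apply/andP/forallP => [[/forallP cm _] e|pI].
  by have := cm (ord0, height ss 0 e); rewrite mir !in_wire_colouring.
split; last by apply/forallP=> i; rewrite atI.
apply/forallP=> -[a h]; have la : (a <= size ss)%N by rewrite -ltnS.
have [e <-] : exists e, height ss a e = h.
  by exists (invF (height_inj ss_strip la) h); rewrite f_invF.
by rewrite mir !in_wire_colouring.
Qed.

(** The crossings of two edges of different colours. The only state oriented by [wire_colouring] is
    vertical exactly there. *)
Definition bichromatic : {set place} :=
  [set y in crossings ss | ((before y.1, y.2) \in wire_colouring) !=
                           ((before y.1, strip_at y.1 y.2) \in wire_colouring)].

Let wire_step k h : ((before k, h) \in wire_colouring) = ((after k, strip_at k h) \in wire_colouring).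
Proof.
have [e <-] := height_onto nice k h.
by rewrite -heightS (in_wire_colouring (before k)) (in_wire_colouring (after k)).
Qed.

Lemma bichromatic_states : proper_colouring I wire_colouring -> bichromatic \in states ss.
Proof.
move=> cP.
  rewrite inE; apply/andP; split; first by apply/subsetP=> y; rewrite inE => /andP[].
  apply/forallP=> y; apply/implyP=> yC.
  rewrite in_set [in X in _ == X]in_set mirror_crossing_in // yC /=.
  have := admits_mirror y true cP; have := admits_mirror y false cP.
  have s1 := wire_step (rev_ord y.1) y.2.
  have s2 := wire_step (rev_ord y.1) (strip_at y.1 y.2).
  have s3 := wire_step y.1 y.2; have := wire_step y.1 (strip_at y.1 y.2).
  move: s1 s2 s3; rewrite /admits /= !strip_at_rev // !strip_atK // => -> -> -> ->.
  by do 4 case: (_ \in wire_colouring).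
Qed.

Let colouring_sum_respects : respects pi I ->
  colouring_sum wire_colouring = state_sign pi bichromatic.
Proof.
rewrite -wire_respects => cP; apply: big_pred1 => x; apply/andP/eqP => [[xS]|->].
  case/(orientsP N_gt0 pi_match nice xS) => cy _; apply/setP=> y; rewrite inE.
  have [yC|yC] := boolP (y \in crossings ss); last first.
    by apply: contraNF yC => /(subsetP (state_sub xS)).
  have := cy y yC; rewrite /admits -wire_step; case: (y \in x) => /andP[] //.
  have := wire_step y.1 (strip_at y.1 y.2); rewrite strip_atK // => <-.
  by move=> /eqP->; rewrite eqxx.
have bS := bichromatic_states cP.
split=> //; apply/(orientsP N_gt0 pi_match nice bS); split=> [y yC|k h kh]; last by rewrite wire_step kh.
rewrite /admits inE yC /=; have := wire_step y.1 y.2.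
have := wire_step y.1 (strip_at y.1 y.2); rewrite strip_atK // => -> ->.
by do 2 case: (_ \in wire_colouring).
Qed.

(** Sum the signs over all pairs of a state and a colouring orienting it. For a fixed state there
    are 2^l colourings or none, which restores the weight; for a fixed colouring everything cancels
    unless it is [wire_colouring]. *)
Lemma state_sum : \sum_(x in states ss | compatible I (state_diagram x)) wt pi x =
  if respects pi I then state_sign pi bichromatic else 0.
Proof.
transitivity (\sum_(c | proper_colouring I c) colouring_sum c).
  rewrite (exchange_big_dep (mem (states ss))) /=; last by move=> ? ? _ /andP[].
  rewrite big_mkcondr; apply: eq_bigr => x xS.
  rewrite (eq_bigl (mem [set c | proper_colouring I c && orients c x])); last first.
    by move=> c; rewrite /= xS in_set.
  rewrite sumr_const card_orientations //; case: ifP => _; last by rewrite mulr0n.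
  by rewrite /wt -/(state_sign pi x) -[RHS]mulr_natl natrX.
have zero c : proper_colouring I c -> c != wire_colouring -> colouring_sum c = 0.
  by move=> cP /eqP ne; apply: contra_not_eq ne => /eqP; apply: colouring_sum_wire.
case: ifP => rI.
  rewrite (bigD1 wire_colouring) ?wire_respects //= big1 ?addr0.
    exact: colouring_sum_respects.
  by move=> c /andP[]; apply: zero.
apply: big1 => c cP; apply: zero => //; apply: contraFneq rI => E.
by rewrite -wire_respects -E.
Qed.

Lemma coeff_sum : \sum_(D in symTL N | compatible I D) coeff ss pi D =
  if respects pi I then state_sign pi bichromatic else 0.
Proof.
rewrite -state_sum /coeff (exchange_big_dep (mem (states ss))) /=; last by move=> ? ? _ /andP[].
rewrite [RHS]big_mkcondr; apply: eq_bigr => x xS; rewrite xS /=.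
case: ifP => comp; last first.
  by apply: big1 => D /andP[/andP[_ DI] /eqP E]; rewrite E DI in comp.
rewrite (big_pred1 (state_diagram x)) // => D /=; rewrite eq_sym.
apply/andP/eqP => [[_ /eqP]//|->]; by rewrite state_diagram_symTL.
Qed.

End WireColouring.

(** * The sign of the surviving state *)

Definition mono_crossings N (I : {set 'I_N}) (pi : {ffun 'I_N -> 'I_N}) : {set 'I_N * 'I_N} :=
  [set ik : 'I_N * 'I_N | [&& ik.1 < ik.2, ik.2 < pi ik.1, pi ik.1 < pi ik.2
     & (ik.1 \in I) == (ik.2 \in I)]%N].

Section CountInversions.
Variables (N : nat) (pi : {ffun 'I_N -> 'I_N}) (I : {set 'I_N}).
Hypotheses (pi_match : pi \in matchings 'I_N) (rI : respects pi I).

Let piK : involutive pi. Proof. exact: matchK. Qed.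
Let piI e : (pi e \in I) = (e \in I). Proof. exact/eqP/(forallP rI). Qed.

(** The pairs of edges of nu(pi), given by their left ends, that have equal colours, are not mirror
    images of each other, and must cross because their right ends are in reversed order. *)
Definition mono_inversions : {set 'I_N * 'I_N} :=
  [set ef : 'I_N * 'I_N | [&& ef.1 < ef.2, pi ef.2 < pi ef.1, ef.2 != pi ef.1
     & (ef.1 \in I) == (ef.2 \in I)]%N].

Let nestings : {set 'I_N * 'I_N} :=
  [set ik : 'I_N * 'I_N | [&& ik.1 < ik.2, ik.2 < pi ik.2, pi ik.2 < pi ik.1
     & (ik.1 \in I) == (ik.2 \in I)]%N].

(** Two arcs of equal colour contribute two inversions if they cross, four if they are nested and
    none if they are side by side; [m] is the number of nestings. *)
Lemma card_mono_inversions :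
  exists m, (#|mono_inversions| = #|mono_crossings I pi|.*2 + m.*2.*2)%N.
Proof.
(* The inversions (e, f) are sorted according to whether e and f open or close their arcs. *)
exists #|nestings|; pose A := [set ef : 'I_N * 'I_N | ef.1 < pi ef.1]%N.
pose B := [set ef : 'I_N * 'I_N | ef.2 < pi ef.2]%N.
pose V := mono_inversions.
have neN (e : 'I_N) : e <> pi e :> nat by move/val_inj/esym/eqP; apply/negP/match_neq.
have V1 : V :&: A :&: B = nestings.
  apply/setP=> -[e f]; rewrite !inE /=.
  case: ((e \in I) == (f \in I)); rewrite ?andbF ?andbT // -!val_eqE /=; lia.
have V2 : #|V :\: A :\: B| = #|nestings|.
  pose t (ef : 'I_N * 'I_N) := (pi ef.2, pi ef.1).
  have tK : involutive t by case=> e f; rewrite /t /= !piK.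
  rewrite -(card_preimset _ (can_inj tK)); congr #|pred_of_set _|.
  apply/setP=> -[e f]; rewrite !inE /= !piK !piI [(f \in I) == _]eq_sym.
  case: ((e \in I) == (f \in I)); rewrite ?andbF ?andbT // -!val_eqE /=.
  have := neN e; have := neN f; lia.
have V4 : (V :\: A) :&: B = set0.
  apply/setP=> -[e f]; rewrite !inE /=; apply/negP => /andP[/andP[? /and4P[? ? _ _]] ?]; lia.
have V3 : #|V :&: A :\: B| = #|mono_crossings I pi :|: nestings|.*2.
  pose W := mono_crossings I pi :|: nestings.
  pose t (ef : 'I_N * 'I_N) := (ef.1, pi ef.2).
  have tK : involutive t by case=> e f; rewrite /t /= !piK.
  pose s (ef : 'I_N * 'I_N) := (ef.2, ef.1).
  have sK : involutive s by case.
  rewrite -(card_preimset _ (can_inj tK)).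
  have -> : t @^-1: (V :&: A :\: B) = W :|: s @^-1: W.
    apply/setP=> -[e f]; rewrite !inE /= !piK !piI [(f \in I) == _]eq_sym.
    have := neN e; have := neN f; have : e = f :> nat -> pi e = pi f :> nat by move/val_inj->.
    have : pi e = pi f :> nat -> e = f :> nat by move/val_inj/(can_inj piK)->.
    case: ((e \in I) == (f \in I)); rewrite ?andbF ?andbT // -!val_eqE /=; lia.
  rewrite [LHS]cardsU (_ : _ :&: _ = set0) ?cards0 ?subn0.
    by rewrite card_preimset ?addnn //; apply: can_inj sK.
  by apply/setP=> -[e f]; rewrite !inE /=; case: ((e \in I) == (f \in I)); lia.
have cU : #|mono_crossings I pi :|: nestings| = (#|mono_crossings I pi| + #|nestings|)%N.
  rewrite cardsU (_ : _ :&: _ = set0) ?cards0 ?subn0 //.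
  by apply/setP=> -[e f]; rewrite !inE /=; case: ((e \in I) == (f \in I)); lia.
rewrite -/V -(cardsID A V) -(cardsID B (V :&: A)) -(cardsID B (V :\: A)) V1 V2 V3 V4 cards0 cU.
by move: #|nestings| #|mono_crossings I pi| => a b; lia.
Qed.

End CountInversions.

Section Sign.
Import GRing.Theory.
Local Open Scope ring_scope.
Variables (N : nat) (ss : seq (strip N)) (pi : {ffun 'I_N -> 'I_N}).
Hypotheses (N_gt0 : (0 < N)%N) (pi_match : pi \in matchings 'I_N).
Hypothesis nice : nice_embedding ss pi.
Variable I : {set 'I_N}.
Hypothesis rI : respects pi I.
Implicit Types (k : 'I_(size ss)) (h e f : 'I_N).
Local Notation place := ('I_(size ss) * 'I_N)%type.

Let ss_strip : all (@is_strip N) ss. Proof. by case: nice. Qed.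
Let ss_rev : rev ss = ss. Proof. by case: nice. Qed.
Let H_inj k : injective (height ss k).
Proof. by apply: height_inj => //; apply: ltnW. Qed.

Definition meetings e f := [set k : 'I_(size ss) | strip_at k (height ss k e) == height ss k f].

(** Two edges exchange their order exactly in the strips where they meet. *)
Lemma height_ltn e f (j : nat) : e != f -> (j <= size ss)%N ->
  (height ss j e < height ss j f)%N = (e < f)%N (+) odd #|[set k in meetings e f | (k < j)%N]|.
Proof.
move=> ef; elim: j => [_|j IH lj].
  rewrite !height0 (_ : [set _ in _ | _] = set0) ?cards0 ?addbF //.
  by apply/setP=> k; rewrite !inE andbF.
pose k := Ordinal lj; rewrite !(heightS k).
rewrite (cardsD1 k) !inE /= ltnSn andbT.
rewrite (_ : _ :\ k = [set k in meetings e f | (k < j)%N]); last first.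
  apply/setP=> k'; rewrite !inE -val_eqE /= ltnS leq_eqVlt.
  by case: eqP => [->|_] /=; rewrite ?ltnn ?andbF //=.
rewrite oddD addbCA -IH ?(ltnW lj) //; move: (H_inj (k := k) (x1 := e) (x2 := f)).
rewrite -/(height ss k e) -[height ss j f]/(height ss k f) /=.
set a := height ss j e; set b := height ss j f => ab.
have {ab} ne : a != b by apply: contraNneq ef => /ab ->.
have := strip_at_le ss_strip k a; have := strip_at_ge ss_strip k a.
have := strip_at_le ss_strip k b; have := strip_at_ge ss_strip k b.
have [sab|nsab] := eqVneq (strip_at k a) b.
  have -> : strip_at k b = a by rewrite -sab strip_atK.
  by rewrite sab; move: ne; rewrite -val_eqE /=; lia.
have : (strip_at k b == strip_at k a) = (b == a) by apply: (can_eq (strip_atK ss_strip k)).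
have : (strip_at k b == a) = (b == strip_at k a).
  by apply: (can2_eq (strip_atK ss_strip k) (strip_atK ss_strip k)).
by move: ne nsab; rewrite -!val_eqE /=; lia.
Qed.

Definition wire k h : 'I_N := invF (@H_inj k) h.

Lemma wireK k h : height ss k (wire k h) = h.
Proof. exact: f_invF. Qed.

Lemma meetings_wire (y : place) : y \in crossings ss ->
  let e := wire y.1 y.2 in let f := wire y.1 (strip_at y.1 y.2) in
  e != f /\ meetings e f = [set y.1].
Proof.
case: y => k h; rewrite inE /= => lt; have ne : wire k h != wire k (strip_at k h).
  apply: contraTneq lt => E; suff -> : strip_at k h = h by rewrite ltnn.
  by rewrite -[LHS](wireK k) -E wireK.
split=> //; apply/setP=> k'; rewrite !inE; apply/eqP/eqP => [m|->]; last by rewrite !wireK.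
by apply: (meet_once nice ne m); rewrite !wireK.
Qed.

(** A crossing is determined by the two edges through it, since these meet only once; for the same
    reason two edges cross if and only if their ends are in reversed order. Being paired excludes
    mirror images, and not being bichromatic means equal colours. *)
Lemma card_paired_bichromatic :
  #|paired ss pi :\: bichromatic ss I| = #|mono_inversions pi I|.
Proof.
pose phi (y : place) := (wire y.1 y.2, wire y.1 (strip_at y.1 y.2)).
have hE := height_end nice; have piK := matchK pi_match.
have col (y : place) : ((before y.1, y.2) \in wire_colouring ss I) = ((phi y).1 \in I).
  by rewrite -{1}(wireK y.1 y.2) (in_wire_colouring nice).
have col' (y : place) : ((before y.1, strip_at y.1 y.2) \in wire_colouring ss I) = ((phi y).2 \in I).
  by rewrite -{1}(wireK y.1 (strip_at y.1 y.2)) (in_wire_colouring nice).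
rewrite -(card_in_imset (f := phi)) => [|y y']; last first.
  rewrite !in_setD => /and3P[_ _ yC] /and3P[_ _ y'C] [E1 E2].
  have [ne m] := meetings_wire yC; have [ne' m'] := meetings_wire y'C.
  have Ek : y.1 = y'.1 by apply/set1P; rewrite -m' -E1 -E2 m set11.
  case: y y' {ne ne' m m' yC y'C E2} E1 Ek => k h [k' h'] /= E1 Ek; subst k'.
  by rewrite -(wireK k h) E1 wireK.
congr #|pred_of_set _|; apply/setP=> -[e f]; apply/imsetP/idP => [[y]|].
  rewrite !in_setD => /and3P[yb yu yC] E.
  have [ne m] := meetings_wire yC; have lt := yC; rewrite inE in lt.
  have [E1 E2] : e = (phi y).1 /\ f = (phi y).2 by rewrite -E.
  rewrite -[wire y.1 y.2]E1 -[wire y.1 (strip_at _ _)]E2 in ne m.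
  have he : height ss y.1 e = y.2 by rewrite E1 wireK.
  have hf : height ss y.1 f = strip_at y.1 y.2 by rewrite E2 wireK.
  have := height_ltn ne (ltnW (ltn_ord y.1)); rewrite he hf lt.
  rewrite (_ : [set _ in _ | _] = set0) ?cards0 ?addbF => [ef|]; last first.
    by apply/setP=> k; rewrite m !inE; case: eqP => [->|]; rewrite ?ltnn.
  have := height_ltn ne (leqnn _); rewrite !hE -ef.
  rewrite (_ : [set _ in _ | _] = [set y.1]) ?cards1 /= => [pif|]; last first.
    by apply/setP=> k; rewrite m !inE ltn_ord andbT.
  rewrite inE /= -ef /=; apply/and3P; split.
  - have : pi e != pi f by rewrite (can_eq piK).
    by rewrite -val_eqE /=; move: pif; lia.
  - apply: contraNneq yu => fE; rewrite inE yC /=; apply/existsP; exists e.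
    by rewrite he eqxx -fE hf eqxx.
  - by move: yb; rewrite inE yC col col' -E1 -E2 /= negbK.
rewrite inE => /and4P[/= ef pif fe eIf].
have ne : e != f by rewrite -val_eqE /=; lia.
have := height_ltn ne (leqnn _); rewrite !hE ef ltnNge (ltnW pif) /=.
case: (set_0Vmem [set k in meetings e f | (k < size ss)%N]) => [->|[k]]; first by rewrite cards0.
rewrite !inE => /andP[/eqP m _] _.
have := height_ltn ne (ltnW (ltn_ord k)); rewrite ef (_ : [set _ in _ | _] = set0); last first.
  apply/setP=> k'; rewrite !inE; apply/negP=> /andP[/eqP m'].
  by rewrite (meet_once nice ne m' m) ltnn.
rewrite cards0 /= => lt; have yC : (k, height ss k e) \in crossings ss by rewrite inE /= m.
have [E1 E2] : wire k (height ss k e) = e /\ wire k (strip_at k (height ss k e)) = f.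
  by split; apply: (@H_inj k); rewrite wireK.
exists (k, height ss k e); last by rewrite /phi /= E1 E2.
rewrite !in_setD yC andbT; apply/andP; split.
  by rewrite inE yC col col' /= E1 E2 eIf.
apply: contraNN fe; rewrite inE yC => /existsP[e' /= /andP[/eqP/H_inj Ee /eqP]].
by rewrite Ee m => /H_inj ->.
Qed.

(** The edges at an unpaired crossing start at e and pi e, of the same colour, so none is vertical
    and [uv] vanishes. Then [ph] is half the number of inversions, and the nestings contribute an
    even number to it. *)
Lemma sign_bichromatic : state_sign pi (bichromatic ss I) = (-1) ^+ #|mono_crossings I pi|.
Proof.
have bS : bichromatic ss I \in states ss.
  by apply: (bichromatic_states nice); rewrite (wire_respects pi_match nice).
have [m Em] := card_mono_inversions pi_match rI.
rewrite /state_sign (_ : uv pi (bichromatic ss I) = 0%N); last first.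
  apply: eq_card0 => y; rewrite in_setI; apply/negP => /andP[].
  rewrite in_set => /andP[yC /existsP[e /andP[/eqP he /eqP hpe]]].
  rewrite in_set => /andP[_].
  have col e0 : ((before y.1, height ss y.1 e0) \in wire_colouring ss I) = (e0 \in I).
    exact: (in_wire_colouring nice I (before y.1) e0).
  rewrite -hpe -he !col.
  by rewrite (eqP (forallP rI e)) eqxx.
have -> : ph pi (bichromatic ss I) = (#|mono_crossings I pi| + m.*2)%N.
  by apply: double_inj; rewrite (card_paired N_gt0 pi_match nice bS) card_paired_bichromatic Em doubleD.
by rewrite add0n exprD -mul2n exprM sqrrN expr1n mulr1.
Qed.

End Sign.

(** * Products of complementary pfaffians *)

Lemma enum_val_ltn N (S : {set 'I_N}) (s t : 'I_#|S|) :
  (enum_val s < enum_val t)%N = (s < t)%N.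
Proof.
have srt : sorted ltn (map val (enum S)).
  rewrite {1}/enum_mem -enumT; apply: (subseq_sorted ltn_trans (s2 := map val (enum 'I_N))).
    exact/map_subseq/filter_subseq.
  by rewrite val_enum_ord iota_ltn_sorted.
have valE (u : 'I_#|S|) : nat_of_ord (enum_val u) = nth 0%N (map val (enum S)) u.
  by rewrite (nth_map (enum_val u)) -?cardE // -enum_val_nth.
have mono (u v : 'I_#|S|) : (u < v)%N -> (enum_val u < enum_val v)%N.
  move=> uv; rewrite !valE; apply: (sorted_ltn_nth ltn_trans 0%N srt) => //.
  1,2: by rewrite inE size_map -cardE.
apply/idP/idP; last exact: mono.
by rewrite !ltnNge; apply: contraNN; rewrite leq_eqVlt => /orP[/eqP/val_inj->|/mono/ltnW].
Qed.

Lemma enum_val_onto N (S : {set 'I_N}) i : i \in S -> exists s : 'I_#|S|, enum_val s = i.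
Proof. by move=> iS; exists (enum_rank_in iS i); rewrite enum_rankK_in. Qed.

Section SplitMatching.
Import GRing.Theory.
Local Open Scope ring_scope.
Variables (N : nat) (I : {set 'I_N}).
Local Notation pairM := ({ffun 'I_#|I| -> 'I_#|I|} * {ffun 'I_#|~: I| -> 'I_#|~: I|})%type.
Implicit Types (p : pairM) (pi : {ffun 'I_N -> 'I_N}).

(** The default [s] is reached only where [pi] leaves S. *)
Definition restrict_matching (S : {set 'I_N}) pi : {ffun 'I_#|S| -> 'I_#|S|} :=
  [ffun s => odflt s [pick t | enum_val t == pi (enum_val s)]].

Definition join_matchings p : {ffun 'I_N -> 'I_N} :=
  [ffun i => if [pick s : 'I_#|I| | enum_val s == i] is Some s then enum_val (p.1 s)
             else if [pick s : 'I_#|~: I| | enum_val s == i] is Some s then enum_val (p.2 s)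
             else i].

Let valI (s : 'I_#|I|) : enum_val s \in I. Proof. exact: enum_valP. Qed.
Let valC (s : 'I_#|~: I|) : enum_val s \in I = false.
Proof. by apply/negbTE; have := enum_valP s; rewrite inE. Qed.

Lemma join_matchingsl p s : join_matchings p (enum_val s) = enum_val (p.1 s).
Proof.
rewrite ffunE; case: pickP => [t /eqP/enum_val_inj-> //|/(_ s)]; by rewrite eqxx.
Qed.

Lemma join_matchingsr p s : join_matchings p (enum_val s) = enum_val (p.2 s).
Proof.
rewrite ffunE; case: pickP => [t /eqP E|_]; first by have := valI t; rewrite E valC.
case: pickP => [t /eqP/enum_val_inj-> //|/(_ s)]; by rewrite eqxx.
Qed.

Lemma restrict_matchingE (S : {set 'I_N}) pi s : pi (enum_val s) \in S ->
  enum_val (restrict_matching S pi s) = pi (enum_val s).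
Proof.
rewrite ffunE; case: pickP => [t /eqP //|none] /enum_val_onto[t E].
by have := none t; rewrite E eqxx.
Qed.

Let split_ord i : (exists s : 'I_#|I|, i = enum_val s) \/ (exists s : 'I_#|~: I|, i = enum_val s).
Proof.
have [iI|iI] := boolP (i \in I); [left|right].
  by have [s <-] := enum_val_onto iI; exists s.
by have [s <-] := enum_val_onto (S := ~: I) (i := i) ltac:(by rewrite inE); exists s.
Qed.

Lemma restrict_matchingK pi : respects pi I ->
  join_matchings (restrict_matching I pi, restrict_matching (~: I) pi) = pi.
Proof.
move=> /forallP rI; apply/ffunP=> i.
have [[s ->]|[s ->]] := split_ord i; rewrite (join_matchingsl, join_matchingsr).
  by rewrite restrict_matchingE // (eqP (rI _)).
by rewrite restrict_matchingE // inE (eqP (rI _)) valC.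
Qed.

Lemma join_matchingsK p : respects (join_matchings p) I /\
  (restrict_matching I (join_matchings p), restrict_matching (~: I) (join_matchings p)) = p.
Proof.
split.
  apply/forallP=> i; have [[s ->]|[s ->]] := split_ord i.
    by rewrite join_matchingsl !valI.
  by rewrite join_matchingsr !valC.
case: p => p1 p2; congr (_, _); apply/ffunP=> s; apply: enum_val_inj.
  by rewrite restrict_matchingE join_matchingsl.
by rewrite restrict_matchingE join_matchingsr // inE valC.
Qed.

Lemma join_matchings_in p : (join_matchings p \in matchings 'I_N) =
  (p.1 \in matchings 'I_#|I|) && (p.2 \in matchings 'I_#|~: I|).
Proof.
rewrite !inE; apply/forallP/andP => [jM|[/forallP M1 /forallP M2] i].
  split; apply/forallP=> s; have := jM (enum_val s).
    by rewrite !join_matchingsl !(inj_eq enum_val_inj).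
  by rewrite !join_matchingsr !(inj_eq enum_val_inj).
have [[s ->]|[s ->]] := split_ord i.
  by rewrite !join_matchingsl !(inj_eq enum_val_inj); apply: M1.
by rewrite !join_matchingsr !(inj_eq enum_val_inj); apply: M2.
Qed.

(** Neither factor sees the crossings of an arc inside I with an arc outside, hence the restriction
    to one colour; [enum_val] is increasing and so preserves crossings. *)
Lemma card_mono_join p : #|mono_crossings I (join_matchings p)| = (cn p.1 + cn p.2)%N.
Proof.
pose vv (S : {set 'I_N}) (st : 'I_#|S| * 'I_#|S|) := (enum_val st.1, enum_val st.2).
have vv_inj S : injective (@vv S) by move=> [a b] [c d] [/enum_val_inj-> /enum_val_inj->].
rewrite -(cardsID [set ik | ik.1 \in I]) /cn -(card_imset _ (@vv_inj I)).
rewrite -(card_imset _ (@vv_inj (~: I))); congr (_ + _)%N; congr #|pred_of_set _|; apply/setP=> -[i k].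
  apply/idP/imsetP => [|[[s t]]].
    rewrite !inE /= => /andP[/and4P[ik kp pp /eqP IE] iI].
    have kI : k \in I by rewrite -IE.
    have [s Es] := enum_val_onto iI; have [t Et] := enum_val_onto kI.
    exists (s, t); last by rewrite /vv /= Es Et.
    by move: ik kp pp; rewrite -Es -Et inE !join_matchingsl !enum_val_ltn /= => -> -> ->.
  rewrite inE /= => H [-> ->].
  by rewrite !inE /= !join_matchingsl !enum_val_ltn !valI eqxx !andbT.
apply/idP/imsetP => [|[[s t]]].
  rewrite !inE /= => /andP[iI /and4P[ik kp pp /eqP IE]].
  have kI : k \notin I by rewrite -IE.
  have [s Es] := enum_val_onto (S := ~: I) (i := i) ltac:(by rewrite inE).
  have [t Et] := enum_val_onto (S := ~: I) (i := k) ltac:(by rewrite inE).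
  exists (s, t); last by rewrite /vv /= Es Et.
  by move: ik kp pp; rewrite -Es -Et inE !join_matchingsr !enum_val_ltn /= => -> -> ->.
rewrite inE /= => H [-> ->].
by rewrite !inE /= !join_matchingsr !enum_val_ltn !valC eqxx !andbT.
Qed.

Variables (K : comNzRingType) (A : 'M[K]_N).

Lemma entry_prod_join p : entry_prod A (join_matchings p) =
  entry_prod (\matrix_(s, t) A (enum_val s) (enum_val t)) p.1 *
  entry_prod (\matrix_(s, t) A (enum_val s) (enum_val t)) p.2.
Proof.
rewrite /entry_prod (bigID (mem I)) /=; congr (_ * _).
  rewrite (eq_bigl (fun i => (i \in I) && (i < join_matchings p i)%N)); last by move=> i; rewrite andbC.
  rewrite big_enum_val_cond; apply: eq_big => s; first by rewrite join_matchingsl enum_val_ltn.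
  by rewrite mxE join_matchingsl.
rewrite (eq_bigl (fun i => (i \in ~: I) && (i < join_matchings p i)%N)); last first.
  by move=> i; rewrite inE andbC.
rewrite big_enum_val_cond; apply: eq_big => s; first by rewrite join_matchingsr enum_val_ltn.
by rewrite mxE join_matchingsr.
Qed.

(** A matching of I together with one of its complement is the same as a matching of all vertices
    that preserves I. *)
Lemma pf_compl_expand : pf_compl A I =
  \sum_(pi in matchings 'I_N | respects pi I) (-1) ^+ #|mono_crossings I pi| * entry_prod A pi.
Proof.
rewrite /pf_compl /pf_sub /pf big_distrlr /= pair_big /=.
rewrite [RHS](reindex_onto join_matchings
  (fun pi => (restrict_matching I pi, restrict_matching (~: I) pi))) /=; last first.
  by move=> pi /andP[_]; apply: restrict_matchingK.
apply: eq_big => [p|p _].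
  by have [r ->] := join_matchingsK p; rewrite eqxx r join_matchings_in !andbT.
by rewrite card_mono_join entry_prod_join exprD mulrACA.
Qed.

End SplitMatching.

Section PfaffianProducts.
Import GRing.Theory.
Local Open Scope ring_scope.
Variables (K : comNzRingType) (N : nat) (emb : {ffun 'I_N -> 'I_N} -> seq (strip N)).
Hypothesis N_gt0 : (0 < N)%N.
Hypothesis emb_nice : forall pi, pi \in matchings 'I_N -> nice_embedding (emb pi) pi.

Lemma pf_compl_diagram (A : 'M[K]_N) (I : {set 'I_N}) :
  pf_compl A I = \sum_(D in symTL N | compatible I D) diagram_pfaf emb A D.
Proof.
rewrite pf_compl_expand /diagram_pfaf exchange_big /= big_mkcondr.
apply: eq_bigr => pi piM; rewrite -mulrz_sumr (coeff_sum N_gt0 piM (emb_nice piM)).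
case: ifP => rI; last by rewrite mulr0z.
rewrite (sign_bichromatic N_gt0 piM (emb_nice piM) rI).
by rewrite -signr_odd -[in RHS]signr_odd; case: odd; rewrite !(expr0, expr1) ?mul1r ?mulr1z ?mulN1r ?mulrN1z.
Qed.

End PfaffianProducts.

(** * Noncrossing partial matchings and symmetric diagrams *)

Section Planar.
Variable N : nat.
Implicit Types (d m : {ffun 'I_N -> 'I_N}) (i j k h : 'I_N).

(* The fixed points stand for the horizontal edges of a symmetric diagram. *)
Definition planar d :=
  [&& [forall i, d (d i) == i],
      [forall i : 'I_N, forall k : 'I_N, ~~ [&& i < k, k < d i & d i < d k]%N]
    & [forall i : 'I_N, forall h : 'I_N, (d h == h) ==> ~~ ((i < h) && (h < d i))%N]].

Lemma planarP d :
  reflect [/\ involutive d,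
              forall i k : 'I_N, (i < k)%N -> (k < d i)%N -> (d i < d k)%N -> False
            & forall i h : 'I_N, d h = h -> (i < h)%N -> (h < d i)%N -> False]
          (planar d).
Proof.
apply: (iffP and3P) => [[/forallP dK /forallP nc /forallP fx]|[dK nc fx]]; split.
- by move=> i; apply/eqP.
- by move=> i k ik kd dd; have /forallP/(_ k) := nc i; rewrite ik kd dd.
- by move=> i h /eqP hh ih hd; have /forallP/(_ h) := fx i; rewrite hh ih hd.
- by apply/forallP=> i; rewrite dK.
- by apply/forallP=> i; apply/forallP=> k; apply/negP=> /and3P[]; apply: nc.
- apply/forallP=> i; apply/forallP=> h; apply/implyP=> /eqP hh.
  by apply/negP=> /andP[]; apply: fx.
Qed.

(** The noncrossing perfect matching [m] extends [d]. As no arc of [m] passes over a fixed point of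
    [d], the fixed points are joined consecutively, the first to the second, the third to the fourth
    and so on; this makes [m] unique. *)
Definition is_closure d m :=
  [&& planar m, [forall i, m i != i], [forall i, (d i != i) ==> (m i == d i)]
    & [forall i : 'I_N, forall h : 'I_N, (d h == h) ==> ~~ ((i < h) && (h < m i))%N]].

Lemma is_closureP d m :
  reflect [/\ planar m, forall i, m i <> i, forall i, d i <> i -> m i = d i
            & forall i h : 'I_N, d h = h -> (i < h)%N -> (h < m i)%N -> False]
          (is_closure d m).
Proof.
apply: (iffP and4P) => [[mp /forallP mN /forallP md /forallP mt]|[mp mN md mt]]; split=> //.
- by move=> i; apply/eqP.
- by move=> i /eqP di; apply/eqP; have := md i; rewrite di.
- by move=> i h /eqP hh ih hd; have /forallP/(_ h) := mt i; rewrite hh ih hd.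
- by apply/forallP=> i; apply/eqP.
- by apply/forallP=> i; apply/implyP=> /eqP /md->.
- apply/forallP=> i; apply/forallP=> h; apply/implyP=> /eqP hh.
  by apply/negP=> /andP[]; apply: mt.
Qed.

(** Induction on the number of fixed points, which is even because N is: join the two smallest ones,
    [h1] and [h2]. No arc of [d] passes over either of them. *)
Lemma closure_exists d : ~~ odd N -> planar d -> exists m, is_closure d m.
Proof.
move=> evN; pose F d := [set h | d h == h].
have [n] := ubnP #|F d|; elim: n d => // n IH d; rewrite ltnS => le dP.
have [dK nc fx] := planarP d dP.
have [F0|[h0 h0F]] := set_0Vmem (F d).
  exists d; have dN i : d i <> i by move=> di; have := in_set0 i; rewrite -F0 inE di eqxx.
  by apply/is_closureP; split=> // i h /dN.
have evF : odd #|F d| = false.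
  have oC : odd #|~: F d| = false.
    by apply: (odd_card_fpf (f := d)) => i; rewrite !inE ?dK // eq_sym.
  have := congr1 odd (cardsC (F d)); rewrite card_ord oddD oC addbF => ->.
  exact/negbTE.
have [h1 h1F h1min] : exists2 h1, h1 \in F d & forall h, h \in F d -> (h1 <= h)%N.
  by case: (arg_minnP (fun h : 'I_N => h : nat) h0F) => h1 h1F h1m; exists h1.
have [h2' h2'F] : exists h, h \in F d :\ h1.
  apply/set0Pn; apply: contraFneq evF => E.
  by rewrite (cardsD1 h1) h1F E cards0.
have [h2 h2F h2min] : exists2 h2, h2 \in F d :\ h1 & forall h, h \in F d :\ h1 -> (h2 <= h)%N.
  by case: (arg_minnP (fun h : 'I_N => h : nat) h2'F) => h2 h2F h2m; exists h2.
have := h2F; rewrite in_setD1 => /andP[h21 h2F'].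
have h12 : (h1 < h2)%N by rewrite ltn_neqAle h1min // andbT eq_sym.
have E1 : d h1 = h1 by apply/eqP; rewrite inE in h1F.
have E2 : d h2 = h2 by apply/eqP; rewrite inE in h2F'.
have low h : d h = h -> (h < h2)%N -> h = h1.
  move=> hh lt; apply/eqP; apply: contraLR lt => hN; rewrite -leqNgt.
  by apply: h2min; rewrite !inE hN hh eqxx.
pose d1 : {ffun 'I_N -> 'I_N} := [ffun i => if i == h1 then h2 else if i == h2 then h1 else d i].
have d1h1 : d1 h1 = h2 by rewrite ffunE eqxx.
have d1h2 : d1 h2 = h1 by rewrite ffunE (negPf h21) eqxx.
have d1E i : i <> h1 -> i <> h2 -> d1 i = d i by rewrite ffunE => /eqP/negPf-> /eqP/negPf->.
have dN1 i : i <> h1 -> d i <> h1 by move=> ne E; apply: ne; rewrite -[i]dK E E1.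
have dN2 i : i <> h2 -> d i <> h2 by move=> ne E; apply: ne; rewrite -[i]dK E E2.
have cases i : [\/ i = h1, i = h2 | i <> h1 /\ i <> h2].
  have [->|/eqP ?] := eqVneq i h1; first exact: Or31.
  by have [->|/eqP ?] := eqVneq i h2; [apply: Or32|apply: Or33].
have d1P : planar d1.
  apply/planarP; split=> [i|i k|i h].
  - case: (cases i) => [->|->|[n1 n2]]; rewrite ?d1h1 ?d1h2 // (d1E _ n1 n2).
    by rewrite d1E ?dK //; [apply: dN1 | apply: dN2].
  - case: (cases i) => [->|->|[i1 i2]]; rewrite ?d1h1 ?d1h2; [|by move: h12; clear; lia|];
      case: (cases k) => [->|->|[k1 k2]]; rewrite ?d1h1 ?d1h2 ?(d1E _ k1 k2); try by move: h12; clear; lia.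
    + by move=> _ lt1 lt2; apply: (fx k h2 E2).
    + by rewrite (d1E _ i1 i2) => lt1 lt2 _; apply: (fx i h1 E1).
    + by rewrite (d1E _ i1 i2); apply: nc.
  - case: (cases h) => [->|->|[n1 n2]]; rewrite ?d1h1 ?d1h2.
    + by move=> E; move: h21; rewrite E eqxx.
    + by move=> E; move: h21; rewrite E eqxx.
    + rewrite (d1E _ n1 n2) => hh; case: (cases i) => [->|->|[i1 i2]]; rewrite ?d1h1 ?d1h2.
      * by move=> _ /(low _ hh).
      * by move: h12; clear; lia.
      * by rewrite (d1E _ i1 i2); apply: fx.
have lt1 : (#|F d1| < n)%N.
  apply: leq_trans le; apply: proper_card; apply/properP; split.
    apply/subsetP=> h; rewrite !inE; case: (cases h) => [->|->|[n1 n2]].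
    - by rewrite d1h1 (negPf h21).
    - by rewrite d1h2 eq_sym (negPf h21).
    - by rewrite d1E.
  by exists h1; rewrite // inE d1h1.
have [m /is_closureP[mP mN md mt]] := IH _ lt1 d1P; exists m.
apply/is_closureP; split=> // [i di|i h hh ih hm].
  by rewrite md d1E // => E; apply: di; rewrite E.
case: (cases h) => [hE|hE|[n1 n2]]; last by apply: (mt i h); rewrite ?d1E.
  rewrite hE in ih hm; case: (cases i) => [iE|iE|[i1 i2]].
  - by rewrite iE ltnn in ih.
  - by move: h12 ih; rewrite iE; clear; lia.
  have [di|/eqP di] := eqVneq (d i) i; last first.
    by apply: (fx i h1) => //; rewrite -(d1E _ i1 i2) -md // d1E.
  by apply: i1; apply: low => //; apply: ltn_trans ih h12.
rewrite hE in ih hm; case: (cases i) => [iE|iE|[i1 i2]].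
- by move: hm; rewrite iE md d1h1 ?ltnn // => E; move: h21; rewrite E eqxx.
- by rewrite iE ltnn in ih.
have [di|/eqP di] := eqVneq (d i) i; last first.
  by apply: (fx i h2) => //; rewrite -(d1E _ i1 i2) -md // d1E.
by apply: i1; apply: low.
Qed.

End Planar.

(** * Parity and uniqueness for noncrossing matchings *)

Section PlanarMatching.
Variable N : nat.
Implicit Types (d m : {ffun 'I_N -> 'I_N}) (i j k h : 'I_N).

Lemma card_interval (x y : nat) : (x <= y)%N -> (y <= N)%N ->
  #|[set z : 'I_N | (x <= z < y)%N]| = (y - x)%N.
Proof.
elim: y => [|y IH] xy yN.
  by apply: eq_card0 => z; rewrite inE ltn0 andbF.
have [yx|xy'] := leqP x y; last first.
  have -> : (y.+1 - x = 0)%N by lia.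
  by apply: eq_card0 => z; rewrite !inE; lia.
rewrite (_ : [set _ | _] = Ordinal yN |: [set z : 'I_N | (x <= z < y)%N]).
  by rewrite cardsU1 IH ?(ltnW yN) // inE /= ltnn andbF subSn.
by apply/setP=> z; rewrite !inE -val_eqE /=; lia.
Qed.

Section FixedPointFree.
Variable m : {ffun 'I_N -> 'I_N}.
Hypotheses (mP : planar m) (mN : forall i, m i <> i).

Let mK : involutive m. Proof. by case/planarP: mP. Qed.
Let nc i k : (i < k)%N -> (k < m i)%N -> (m i < m k)%N -> False.
Proof. by case/planarP: mP => _ + _; apply. Qed.
Let mN' i : m i <> i :> nat. Proof. by move/val_inj/mN. Qed.
Let m_inj i k : m i = m k :> nat -> i = k :> nat.
Proof. by move/val_inj/(can_inj mK)->. Qed.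

Let m_swap z i : m z = i :> nat -> z = m i :> nat.
Proof. by move/val_inj<-; rewrite mK. Qed.

Lemma odd_closed_interval (x y : nat) : (x <= y)%N -> (y <= N)%N ->
  (forall z : 'I_N, (x <= z < y)%N -> (x <= m z < y)%N) -> odd (y - x) = false.
Proof.
move=> xy yN cl; rewrite -(card_interval xy yN); apply: (odd_card_fpf (f := m)) => z; rewrite inE.
- by move/cl; rewrite inE.
- by [].
- by move=> _; apply/eqP/mN.
Qed.

(** The points strictly under an arc are matched among themselves. *)
Lemma odd_match i : odd (m i) = ~~ odd i.
Proof.
wlog lt : i / (i < m i)%N => [hw|].
  have [lt|gt|/esym/mN'//] := ltngtP i (m i); first exact: hw.
  by have := hw (m i); rewrite mK => /(_ gt) ->; rewrite negbK.
have := @odd_closed_interval i.+1 (m i) lt (ltnW (ltn_ord _)).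
suff H (z : 'I_N) : (i < z < m i)%N -> (i < m z < m i)%N.
  move/(_ H) => E; have Em : m i = (m i - i.+1 + i.+1)%N :> nat by rewrite subnK.
  by rewrite Em oddD E.
move=> /andP[iz zm].
have ne1 : m z <> i :> nat by move/m_swap; lia.
have ne2 : m z <> m i :> nat by move/m_inj; lia.
have [lt1|] := ltnP (m z) (m i); last first.
  by move=> le; exfalso; apply: (nc iz zm); lia.
rewrite andbT ltnNge; apply/negP=> le.
by apply: (@nc (m z) i); rewrite ?mK //; lia.
Qed.

(** When no arc passes over [h], the points before the arc of [h] are matched among themselves, so
    this arc opens at an even position (counted from 0) and closes at an odd one. *)
Lemma top_match h : (forall i, (i < h)%N -> (h < m i)%N -> False) ->
  odd h = (m h < h)%N.
Proof.
move=> top; have [lt|gt|/mN'//] := ltngtP (m h) h; last first.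
  have := odd_closed_interval (leq0n h) (ltnW (ltn_ord h)); rewrite subn0 => -> // z /= zh.
  have ne : m z <> h :> nat by move/m_swap; lia.
  by rewrite ltnNge; apply/negP=> le; apply: (top z) => //; lia.
have top' i : (i < m h)%N -> (m h < m i)%N -> False.
  move=> ih hm; have [lt'|] := ltnP h (m i); first by apply: (top i) => //; lia.
  rewrite leq_eqVlt => /orP[/eqP E|lt'].
    by have := m_swap E; lia.
  by apply: (nc ih hm); rewrite mK.
apply/negPn; rewrite -odd_match.
have := odd_closed_interval (leq0n (m h)) (ltnW (ltn_ord _)); rewrite subn0 => -> // z /= zh.
have ne : m z <> m h :> nat by move/m_inj; lia.
by rewrite ltnNge; apply/negP=> le; apply: (top' z) => //; lia.
Qed.

(* For the innermost such j, the points strictly between j and a are matched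
   among themselves. *)
Lemma enclosed_by_odd (a i : 'I_N) : (a < m a)%N -> ~~ odd a -> (i < a)%N -> (a < m i)%N ->
  exists2 j : 'I_N, odd j & (j < a)%N /\ (m a < m j)%N.
Proof.
move=> am ea ia ami.
pose P := [pred k : 'I_N | (k < a)%N && (a < m k)%N].
have Pi : P i by rewrite /= ia ami.
case: (arg_maxnP (fun k : 'I_N => k : nat) Pi) => j /= /andP[ja amj] jmax.
have mam : (m a < m j)%N.
  rewrite ltn_neqAle; apply/andP; split; first by apply/eqP=> /m_inj; lia.
  by rewrite leqNgt; apply/negP; apply: (nc ja amj).
exists j => //; have := @odd_closed_interval j.+1 a ja (ltnW (ltn_ord _)).
suff H (z : 'I_N) : (j < z < a)%N -> (j < m z < a)%N.
  move/(_ H) => E; have Ea : a = (a - j.+1 + j.+1)%N :> nat by rewrite subnK.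
  by move: ea; rewrite Ea oddD E /= negbK.
case/andP=> jz za; apply/andP; split.
  have ne : m z <> j :> nat by move/m_swap; lia.
  rewrite ltnNge; apply/negP=> le.
  apply: (@nc (m z) j); rewrite ?mK; lia.
have ne : m z <> a :> nat by move/m_swap; lia.
rewrite ltnNge; apply/negP=> le.
have := jmax z; rewrite za /=; have -> : (a < m z)%N by lia.
by move/(_ isT); lia.
Qed.

End FixedPointFree.

Section Closure.
Variables (d m : {ffun 'I_N -> 'I_N}).
Hypothesis dP : planar d.
Hypothesis mC : is_closure d m.

Let dK : involutive d. Proof. by case/planarP: dP. Qed.
Let mP : planar m. Proof. by case/is_closureP: mC. Qed.
Let mK : involutive m. Proof. by case/planarP: mP. Qed.
Let mN i : m i <> i. Proof. by case/is_closureP: mC => _ + _ _; apply. Qed.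
Let md i : d i <> i -> m i = d i. Proof. by case/is_closureP: mC => _ _ + _; apply. Qed.
Let mt i h : d h = h -> (i < h)%N -> (h < m i)%N -> False.
Proof. by case/is_closureP: mC => _ _ _; apply. Qed.

Lemma closure_fixed h : d h = h -> d (m h) = m h.
Proof.
move=> hh; apply/eqP/negPn/negP => /eqP ne; have := md ne; rewrite mK => E.
by case: (mN (i := h)); rewrite -[m h]dK -E hh.
Qed.

(** The arcs added to [d] are outer, so they open at even positions counted from 0: as edges of a
    diagram they would be odd, hence erasable. *)
Lemma closure_fixed_odd h : d h = h -> odd h = (m h < h)%N.
Proof. by move=> hh; apply: (top_match mP mN) => i; apply: mt. Qed.

End Closure.

(** By parity, both partners of a fixed point [h] lie on the same side of it; the arc to the farther
    one would pass over the nearer one, which is a fixed point of [d] too. *)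
Lemma closure_unique d m1 m2 : planar d -> is_closure d m1 -> is_closure d m2 -> m1 = m2.
Proof.
move=> dP C1 C2; apply/ffunP=> h.
have /is_closureP[_ mN1 md1 mt1] := C1; have /is_closureP[_ mN2 md2 mt2] := C2.
have [hh|/eqP ne] := eqVneq (d h) h; last by rewrite md1 // md2.
have f1 := closure_fixed dP C1 hh; have f2 := closure_fixed dP C2 hh.
have o1 := closure_fixed_odd C1 hh; have o2 := closure_fixed_odd C2 hh.
have n1 : m1 h <> h :> nat by move/val_inj/mN1.
have n2 : m2 h <> h :> nat by move/val_inj/mN2.
have /planarP[mK1 _ _] : planar m1 by case/is_closureP: C1.
have /planarP[mK2 _ _] : planar m2 by case/is_closureP: C2.
apply: val_inj; have [lt|gt|//] := ltngtP (m1 h) (m2 h).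
  have [hl|hl] := ltnP h (m1 h); first by case: (mt2 h (m1 h)) => //; lia.
  by case: (mt1 (m1 h) (m2 h)) => //; rewrite mK1; lia.
have [hl|hl] := ltnP h (m2 h); first by case: (mt1 h (m2 h)) => //; lia.
by case: (mt2 (m2 h) (m1 h)) => //; rewrite mK2; lia.
Qed.

Definition openers d : {set 'I_N} := [set i : 'I_N | i < d i]%N.

(** Read the openers as opening brackets: as no fixed point lies under an arc, every other vertex
    closes the last open bracket if there is one, and is fixed otherwise. *)
Lemma openers_inj d1 d2 : planar d1 -> planar d2 -> openers d1 = openers d2 -> d1 = d2.
Proof.
move=> P1 P2 O12; have /planarP[K1 nc1 fx1] := P1; have /planarP[K2 nc2 fx2] := P2.
have O (i : 'I_N) : (i < d1 i)%N = (i < d2 i)%N by have /setP/(_ i) := O12; rewrite !inE.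
(* The nearer end [e1 i] lies under the arc of [e2] at [i] and is not an opener. For [e2] it would
   be fixed or close an arc opened before, at or after [i]; the last case contradicts the agreement
   at later openers. *)
have step (e1 e2 : {ffun 'I_N -> 'I_N}) (i : 'I_N) : involutive e1 -> planar e2 ->
    (forall i : 'I_N, (i < e1 i)%N = (i < e2 i)%N) ->
    (forall k : 'I_N, (i < k)%N -> (k < e1 k)%N -> e1 k = e2 k) ->
    (i < e1 i)%N -> (e1 i < e2 i)%N -> False.
  move=> eK /planarP[eK2 nc fx] OO IH ie lt.
  have : ~~ (e1 i < e2 (e1 i))%N by rewrite -OO eK; lia.
  rewrite -leqNgt leq_eqVlt => /orP[/eqP/val_inj E|gt]; first exact: (fx i (e1 i)).
  pose k := e2 (e1 i); have e2k : e2 k = e1 i by rewrite eK2.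
  have ok : (k < e1 k)%N by rewrite OO e2k.
  have [lt'|gt'|/val_inj E] := ltngtP k i.
  - by apply: (nc k i) => //; rewrite e2k.
  - by have := IH k gt' ok; rewrite e2k => /(can_inj eK) E; rewrite E ltnn in gt'.
  - by move: lt; rewrite -e2k E ltnn.
have opE (i : 'I_N) : (i < d1 i)%N -> d1 i = d2 i.
  have [n] := ubnP (N - i); elim: n i => // n IH i le lt.
  have IH' (k : 'I_N) : (i < k)%N -> (k < d1 k)%N -> d1 k = d2 k.
    by move=> ik; apply: IH; have := ltn_ord k; lia.
  apply: val_inj; have [l|l|//] := ltngtP (d1 i) (d2 i).
    by case: (step d1 d2 i).
  case: (step d2 d1 i) => //; last by rewrite -O.
  by move=> k ik; rewrite -O => ok; rewrite IH'.
apply/ffunP=> i; have [/opE//|] := boolP (i < d1 i)%N.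
rewrite -leqNgt leq_eqVlt => /orP[/eqP/val_inj E|gt]; last first.
  have : (d1 i < d1 (d1 i))%N by rewrite K1.
  by move/opE; rewrite K1 => E; rewrite {2}E K2.
have [gt|lt|/val_inj->//] := ltngtP (d2 i) i.
  have := opE (d2 i); rewrite O K2 => /(_ gt) E'.
  by rewrite -[in LHS]E' K1.
by move: lt; rewrite -O E ltnn.
Qed.

End PlanarMatching.

Section SymmetricDiagrams.
Variable N : nat.
Implicit Types (d m : {ffun 'I_N -> 'I_N}) (i j k h : 'I_N) (D : diagram N) (p q : point N).

Definition left_part D : {ffun 'I_N -> 'I_N} := [ffun i => label (D (inl i))].

Definition symmetric_diagram d : diagram N :=
  [ffun p => if d (label p) == label p then mirror p else
             match p with inl i => inl (d i) | inr i => inr (d i) end].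

Lemma symmetric_diagramK d : left_part (symmetric_diagram d) = d.
Proof. by apply/ffunP=> i; rewrite !ffunE /=; case: eqP. Qed.

Lemma symTL_left D : D \in symTL N ->
  planar (left_part D) /\ symmetric_diagram (left_part D) = D.
Proof.
rewrite !inE => /and3P[/forallP DM /forallP nc /forallP ms].
have DK p : D (D p) = p by have /andP[/eqP] := DM p.
have DN p : D p <> p by have /andP[_ /eqP] := DM p.
have {}ms p : D (mirror p) = mirror (D p) by apply/eqP.
have {}nc p q : (rim p < rim q)%N -> (rim q < rim (D p))%N -> (rim (D p) < rim (D q))%N -> False.
  by move=> h1 h2 h3; have /forallP/(_ q) := nc p; rewrite h1 h2 h3.
pose d := left_part D; have dE i : d i = label (D (inl i)) by rewrite ffunE.
have DE i : D (inl i) = if d i == i then inr i else inl (d i).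
  rewrite dE; case E: (D (inl i)) => [j|j] /=.
    by case: eqP => // ji; case: (DN (inl i)); rewrite E ji.
  (* An edge from i to j' with j different from i would cross its mirror image from j to i'. *)
  case: eqP => [->//|ne]; exfalso.
  have Ej : D (inl j) = inr i by rewrite -[inl j]/(mirror (inr j)) ms -E DK.
  have ne' : j <> i :> nat by move/val_inj.
  have := ltn_ord i; have := ltn_ord j => lj li.
  have [lt|gt] : (i < j)%N \/ (j < i)%N by lia.
    by apply: (nc (inl i) (inl j)); rewrite ?E ?Ej /=; lia.
  by apply: (nc (inl j) (inl i)); rewrite ?E ?Ej /=; lia.
have dK i : d (d i) = i.
  have := DK (inl i); rewrite [D (inl i)]DE; case: eqP => [di _|ne]; first by rewrite !di.
  by rewrite DE; case: eqP => // _ [].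
split.
  apply/planarP; rewrite -/d; split=> [//|i k ik kd dd|i h hh ih hd].
    have ni : d i <> i by move=> E; rewrite E in kd; lia.
    have nk : d k <> k by move=> E; rewrite E in dd; lia.
    by apply: (nc (inl i) (inl k)) => //; rewrite !DE (introF eqP ni) ?(introF eqP nk).
  have ni : d i <> i by move=> E; rewrite E in hd; lia.
  apply: (nc (inl i) (inl h)) => //; rewrite !DE (introF eqP ni) //=.
  by rewrite hh eqxx /=; have := ltn_ord (d i); lia.
apply/ffunP=> -[i|i]; rewrite ffunE /= -/d; first by rewrite DE.
by rewrite -[inr i]/(mirror (inl i)) ms DE; case: eqP.
Qed.

Lemma symmetric_diagram_symTL d : planar d -> symmetric_diagram d \in symTL N.
Proof.
move=> dP; have [dK nc fx] := planarP d dP.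
have DE p : symmetric_diagram d p = if d (label p) == label p then mirror p else
             match p with inl i => inl (d i) | inr i => inr (d i) end by rewrite ffunE.
rewrite !inE; apply/and3P; split.
- apply/forallP=> p; have [E|ne] := eqVneq (d (label p)) (label p).
    have Ep : symmetric_diagram d p = mirror p by rewrite DE E eqxx.
    rewrite Ep DE; have -> : label (mirror p) = label p by case: (p).
    by rewrite E eqxx mirrorK eqxx; case: (p).
  have Ep : symmetric_diagram d p = match p with inl i => inl (d i) | inr i => inr (d i) end.
    by rewrite DE (negPf ne).
  rewrite Ep; case: p ne {Ep} => i /= ne;
    have ne' : (i == d i) = false by rewrite eq_sym (negPf ne).
    by rewrite DE /= dK ne' eqxx /=; apply: contraNneq ne => -[->].
  by rewrite DE /= dK ne' eqxx /=; apply: contraNneq ne => -[->].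
- apply/forallP=> p; apply/forallP=> q; apply/negP=> /and3P[].
  case: p => i; case: q => k; rewrite ?DE /=; have := ltn_ord i; have := ltn_ord k => lk li;
    do 2 (case: eqP => /= ?); have := ltn_ord (d i); have := ltn_ord (d k); try lia.
  + by move=> _ _ ik kd _; apply: (fx i k).
  + by move=> _ _; apply: nc.
  + by move=> _ _ ik kd dd; apply: (fx (d k) i); rewrite ?dK //; lia.
  + by move=> _ _ ik kd dd; apply: (nc (d k) (d i)); rewrite ?dK; lia.
- by apply/forallP=> p; rewrite !DE; case: p => i /=; case: (d i == i).
Qed.

Lemma card_left_edges d : involutive d -> TL_order (symmetric_diagram d) = #|openers d|.
Proof.
move=> dK; rewrite -(card_imset (f := fun i => (i, d i)) (openers d)); last by move=> i j [].
congr #|pred_of_set _|; apply/setP=> -[i j]; rewrite inE /= ffunE /=.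
apply/andP/imsetP => [[ij]|[k kO [-> ->]]].
  by case: (d i == i) => // /eqP[E]; exists i; rewrite ?inE E.
rewrite inE in kO; have /negPf-> : d k != k by apply: contraTneq kO => ->; rewrite ltnn.
by rewrite kO.
Qed.

(** Erasing keeps the closure because only outer edges can go. Under an arc, an erased edge would
    also lie under an arc opening at an odd position counted from 0. That arc belongs to [d], since
    added arcs open at even positions, and is not erased, so D' would have a horizontal edge meeting
    a vertical one. *)
Lemma erasures_closure d m D' : planar d -> is_closure d m ->
    D' \in erasures (symmetric_diagram d) ->
  [/\ planar (left_part D'), symmetric_diagram (left_part D') = D',
      is_closure (left_part D') m
    & forall i, left_part D' i <> i -> left_part D' i = d i].
Proof.
move=> dP mC; rewrite inE => /andP[D'TL /existsP[E /andP[/subsetP sE /eqP D'E]]].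
have [d'P D'K] := symTL_left D'TL; set d' := left_part D' in d'P D'K *.
have /is_closureP[mP mN md mt] := mC; have /planarP[mK mnc _] := mP.
have [dK nc fx] := planarP d dP.
pose erased i := [exists ij : 'I_N * 'I_N in E, (i == ij.1) || (i == ij.2)].
have d'E i : d' i = if erased i then i else d i.
  rewrite ffunE D'E ffunE /= -/(erased i); case: ifP => //= _.
  by rewrite ffunE /=; case: eqP => [->|].
have EP ij : ij \in E -> [/\ ~~ odd ij.1, (ij.1 < ij.2)%N & d ij.1 = ij.2].
  move/sE; rewrite !inE ffunE /= => /andP[/andP[lt]].
  by case: (d ij.1 == ij.1) => // /eqP[].
have erasedP i : erased i -> exists a : 'I_N, [/\ ~~ odd a, (a < d a)%N, erased a & i = a \/ i = d a].
  case/existsP=> -[a b] /andP[abE /= iab]; have [/= oa ab da] := EP _ abE.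
  exists a; rewrite da; split=> //; last by case/orP: iab => /eqP; [left|right].
  by apply/existsP; exists (a, b); rewrite abE eqxx.
have d'd i : d' i <> i -> d' i = d i by rewrite d'E; case: ifP.
split=> //; apply/is_closureP; split=> // [i di|i h].
  by rewrite d'd // md // -d'd.
rewrite d'E; case: ifP => [/erasedP[a [ea ada era ha]] _|_]; last exact: mt.
have mda : m a = d a by apply: md => Eq; rewrite Eq ltnn in ada.
(* By noncrossing, an arc over either end of the erased arc passes over its opener [a]. *)
move=> ih hm; have iam : (i < a)%N && (a < m i)%N.
  case: ha => hE; first by rewrite -hE ih hm.
  subst h; have [lt|gt|/val_inj Eq] := ltngtP i a.
  - by rewrite (ltn_trans ada hm).
  - by case: (mnc a i gt); rewrite ?mda.
  - by rewrite Eq mda ltnn in hm.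
case/andP: iam => ia ami; rewrite -mda in ada.
have [j oj [ja amj]] := enclosed_by_odd mP mN ada ea ia ami.
have dj : d j <> j.
  move=> dj; have := closure_fixed_odd mC dj; rewrite oj => /esym lt; move: lt ja amj ada; clear; lia.
have mj := md _ dj; have nej : ~~ erased j.
  apply/negP=> /erasedP[b [eb bdb _ [jb|jb]]]; first by move: oj; rewrite jb (negPf eb).
  by rewrite mj jb dK in amj; rewrite jb in ja; lia.
have d'j : d' j = d j by rewrite d'E (negPf nej).
have [_ _ fx'] := planarP d' d'P; apply: (fx' j a) => //; last by rewrite d'j -mj; lia.
by rewrite d'E era.
Qed.

End SymmetricDiagrams.

(** * Products of pfaffians as sums of TL-pfaffinants *)

Section Decomposition.
Variable N : nat.
Hypothesis N_even : ~~ odd N.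
Implicit Types (d m : {ffun 'I_N -> 'I_N}) (i j k h : 'I_N) (D : diagram N) (I : {set 'I_N}).

Definition closure d := odflt d [pick m | is_closure d m].

Lemma closureP d : planar d -> is_closure d (closure d).
Proof.
move=> /(closure_exists N_even)[m mC]; rewrite /closure.
by case: pickP => [//|/(_ m)]; rewrite mC.
Qed.

Lemma closureE d m : planar d -> is_closure d m -> closure d = m.
Proof. by move=> dP mC; apply: closure_unique mC => //; apply: closureP. Qed.

Lemma compatibleP I d :
  reflect (forall i, twist I (d i) = twist I i) (compatible I (symmetric_diagram d)).
Proof.
have E p : label (symmetric_diagram d p) = d (label p).
  by rewrite ffunE; case: eqP => [->|_]; case: p.
apply: (iffP forallP) => [tI i|tI p]; last by rewrite E tI.
by have /eqP := tI (inl i); rewrite E.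
Qed.

Lemma twist_match I m i : planar m -> (forall i, m i <> i) ->
  (twist I (m i) == twist I i) = ((m i \in I) != (i \in I)).
Proof.
move=> mP mN; rewrite /twist (odd_match mP mN).
by case: (_ \in I); case: (_ \in I); case: odd.
Qed.

(** By [twist_match], unequal twists on an arc of the closure mean that both ends are on the same
    side of I. Thus a basic diagram is determined by I and its closure. *)
Definition basic I D := compatible I D &&
  [forall h, (left_part D h == h) ==> (twist I (closure (left_part D) h) != twist I h)].

Lemma erasures_compatible I D D' : D \in symTL N -> compatible I D -> D' \in erasures D ->
  D' \in symTL N /\ compatible I D'.
Proof.
move=> /symTL_left[dP DK] cI D'D; have D'TL : D' \in symTL N.
  by move: D'D; rewrite inE => /andP[].
split=> //; rewrite -DK in D'D cI.
have [_ ED' _ d'd] := erasures_closure dP (closureP dP) D'D; rewrite -ED'.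
apply/compatibleP=> i; have [->//|/eqP/d'd ->] := eqVneq (left_part D' i) i.
exact: (compatibleP _ _ cI).
Qed.

(** Since erasing keeps the closure m, the only candidate for D consists of the arcs of m that join
    I to its complement. Its edges beyond those of D' are arcs added in the closure of D', hence odd
    edges, and they may be erased. *)
Lemma erasure_of_basic I D' : D' \in symTL N -> compatible I D' ->
  exists D, forall D2, [&& D2 \in symTL N, basic I D2 & D' \in erasures D2] = (D2 == D).
Proof.
move=> D'TL cI; have [d'P D'K] := symTL_left D'TL; set d' := left_part D' in d'P D'K.
have mC := closureP d'P; set m := closure d' in mC.
have /is_closureP[mP mN md mt] := mC; have /planarP[mK mnc _] := mP.
have /planarP[d'K _ _] := d'P.
rewrite -D'K in cI; have {}cI := compatibleP _ _ cI.
pose d : {ffun 'I_N -> 'I_N} := [ffun i => if twist I (m i) == twist I i then m i else i].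
have dE i : d i = if twist I (m i) == twist I i then m i else i by rewrite ffunE.
have d_m i : d i <> i -> d i = m i by rewrite dE; case: ifP.
have d'_d i : d' i <> i -> d i = d' i.
  by move=> ne; rewrite dE (md _ ne) cI eqxx.
have dP : planar d.
  apply/planarP; split=> [i|i k ik kd dd|i h hh ih hd].
  - rewrite [d i]dE; case: eqP => [E|ne]; last by rewrite dE; case: eqP.
    by rewrite dE mK -E eqxx.
  - have ei : d i = m i by apply: d_m => E; rewrite E in kd; lia.
    have ek : d k = m k by apply: d_m => E; rewrite E in dd; lia.
    by apply: (mnc i k ik); rewrite -?ei // -ek.
  - have ei : d i = m i by apply: d_m => E; rewrite E in hd; lia.
    apply: (mt i h) => //; last by rewrite -ei.
    by apply/eqP/negPn/negP => /eqP ne; apply: (ne); rewrite -(d'_d _ ne).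
have mCd : is_closure d m.
  apply/is_closureP; split=> // [i /d_m //|i h hh]; apply: mt.
  by apply/eqP/negPn/negP => /eqP ne; apply: (ne); rewrite -(d'_d _ ne).
exists (symmetric_diagram d) => D2; apply/and3P/eqP => [[D2TL /andP[c2 b2] er]|->].
  have [d2P D2K] := symTL_left D2TL; set d2 := left_part D2 in d2P D2K b2.
  rewrite -D2K in er c2; have {}c2 := compatibleP _ _ c2.
  have [_ _ C2 _] := erasures_closure d2P (closureP d2P) er.
  have E2 : closure d2 = m by rewrite /m (closureE _ C2).
  rewrite -D2K; congr symmetric_diagram; apply/ffunP=> i; rewrite dE.
  have /is_closureP[_ _ md2 _] := closureP d2P; rewrite E2 in md2.
  have [hh|/eqP ne] := eqVneq (d2 i) i.
    have /forallP/(_ i) := b2; rewrite hh eqxx E2 => /negPf ->; by [].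
  by rewrite (md2 _ ne) c2 eqxx.
have clE : closure d = m by apply: closureE.
split; first exact: symmetric_diagram_symTL.
  apply/andP; split.
    by apply/compatibleP=> i; rewrite dE; case: eqP.
  rewrite symmetric_diagramK clE; apply/forallP=> h; apply/implyP; rewrite dE.
  by case: (twist I (m h) == _) => //= /eqP mh; case: (mN h mh).
rewrite inE D'TL /=.
pose E := [set ij : 'I_N * 'I_N | [&& (ij.1 < ij.2)%N, d' ij.1 == ij.1 & d ij.1 == ij.2]].
have dK : involutive d by case/planarP: dP.
have ErP i : [exists ij : 'I_N * 'I_N in E, (i == ij.1) || (i == ij.2)] = (d' i == i) && (d i != i).
  apply/existsP/andP => [[[a b]]|[d'i di]].
    rewrite inE /= => /andP[/and3P[ab /eqP d'a /eqP da]].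
    have ne : d a <> a by move=> Eq; rewrite -da Eq ltnn in ab.
    case/orP => /eqP->; first by rewrite d'a; split=> //; apply/eqP.
    rewrite -da dK (eq_sym a); split; last by apply/eqP.
    by rewrite (d_m _ ne) (closure_fixed d'P mC).
  have ne : d i <> i by apply/eqP.
  have [lt|gt|/val_inj Eq] := ltngtP i (d i); last by case: ne.
    by exists (i, d i); rewrite inE /= lt d'i !eqxx.
  exists (d i, i); rewrite inE /= gt dK !eqxx orbT andbT.
  by rewrite (d_m _ ne) (closure_fixed d'P mC) ?eqxx //; apply/eqP.
apply/existsP; exists E; apply/andP; split.
  apply/subsetP=> -[a b]; rewrite !inE /= => /and3P[ab /eqP d'a /eqP da].
  have ne : d a <> a by move=> Eq; rewrite -da Eq ltnn in ab.
  rewrite ab ffunE /= (introF eqP ne) da eqxx /=.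
  by rewrite (closure_fixed_odd mC d'a) -(d_m _ ne) da; lia.
apply/eqP; rewrite -{1}D'K; apply/ffunP=> p; rewrite [LHS]ffunE [RHS]ffunE ErP [symmetric_diagram d p]ffunE.
have [d'p|/eqP ne] := eqVneq (d' (label p)) (label p); rewrite /=.
  by case: eqP => //= ->; rewrite eqxx.
by rewrite !(d'_d _ ne) (introF eqP ne); case: (p) ne => i /= /d'_d ->.
Qed.

(** I contains one end of each vertical edge of D, and both ends or none of each arc added in the
    closure; so its size and the order of D have the same parity. *)
Lemma basic_even I D : ~~ odd #|I| -> D \in symTL N -> basic I D -> ~~ odd (TL_order D).
Proof.
move=> I_even /symTL_left[dP DK] /andP[cI /forallP bI]; rewrite -DK in cI *.
set d := left_part D in dP DK cI bI *; have {}cI := compatibleP _ _ cI.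
have mC := closureP dP; set m := closure d in mC bI.
have /is_closureP[mP mN md mt] := mC; have /planarP[mK mnc _] := mP.
have /planarP[dK _ _] := dP; rewrite card_left_edges //.
pose F := [set h | d h == h].
have evF : odd #|I :&: F| = false.
  apply: (odd_card_fpf (f := m)) => [h|//|h _]; last by apply/eqP/mN.
  rewrite !inE => /andP[hI dh]; have := bI h; rewrite dh twist_match // hI negbK => /eqP ->.
  by rewrite (closure_fixed dP mC) ?eqxx //; apply/eqP.
have V : #|I :\: F| = #|openers d|.
  rewrite -(cardsID I (openers d)) -(cardsID (openers d) (I :\: F)); congr (_ + _)%N.
    congr #|pred_of_set _|; apply/setP=> i; rewrite !inE.
    by case: (i \in I); rewrite ?andbF //= !andbT; case: eqP => //= ->; rewrite ltnn.
  rewrite -(card_preimset _ (can_inj dK)); congr #|pred_of_set _|; apply/setP=> i.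
  rewrite !inE dK; have [E|/eqP ne] := eqVneq (d i) i.
    by rewrite E ltnn !andbF.
  have := cI i; rewrite -(md _ ne) => /eqP; rewrite twist_match // (md _ ne).
  have ne' : d i <> i :> nat by move/val_inj.
  by case: (i \in I); case: (d i \in I) => //= _; rewrite ?andbF //=; lia.
by rewrite -V; move: I_even; rewrite -(cardsID F I) oddD evF.
Qed.

End Decomposition.

Section TLExpansion.
Import GRing.Theory.
Local Open Scope ring_scope.
Variables (K : comNzRingType) (N : nat) (emb : {ffun 'I_N -> 'I_N} -> seq (strip N)).
Hypothesis N_gt0 : (0 < N)%N.
Hypothesis N_even : ~~ odd N.
Hypothesis emb_nice : forall pi, pi \in matchings 'I_N -> nice_embedding (emb pi) pi.

(** Each compatible diagram in [pf_compl_diagram] is an erasure of exactly one basic diagram, so the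
    sum can be regrouped. *)
Lemma pf_compl_TL (A : 'M[K]_N) (I : {set 'I_N}) : ~~ odd #|I| ->
  pf_compl A I = \sum_(D in even_symTL N | basic I D) TL_pfaf emb A D.
Proof.
move=> I_even; rewrite (pf_compl_diagram N_gt0 emb_nice) /TL_pfaf.
rewrite (exchange_big_dep (fun D' => (D' \in symTL N) && compatible I D')) /=; last first.
  move=> D D' /andP[]; rewrite inE => /andP[DTL _] /andP[cI _] er.
  by apply/andP; apply: (erasures_compatible N_even DTL cI).
apply: eq_bigr => D' /andP[D'TL cI].
have [D uD] := erasure_of_basic N_even D'TL cI.
rewrite (big_pred1 D) // => D2; rewrite /= -uD inE.
case DTL: (D2 \in symTL N) => //=; case bD: (basic I D2); rewrite ?andbF //=.
by rewrite (basic_even N_even I_even DTL bD).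
Qed.

End TLExpansion.

(** * Triangularity *)

Section Triangularity.
Variable N : nat.
Implicit Types (d : {ffun 'I_N -> 'I_N}) (i j k h : 'I_N) (D : diagram N) (I : {set 'I_N}).

(** The summand is positive even at the vertex 0, so that a proper subset of a set of openers has
    strictly smaller weight. *)
Definition opener_weight d := (\sum_(i in openers d) i.+1)%N.

(* Each edge of d contains one opener of d', at or after its first vertex. *)
Lemma split_edges_weight d d' : planar d -> planar d' ->
    (forall i, d i <> i -> (d i \in openers d') != (i \in openers d')) ->
  d = d' \/ (opener_weight d < opener_weight d')%N.
Proof.
move=> dP d'P sp; have /planarP[dK _ _] := dP.
pose f i := if i \in openers d' then i else d i.
have op_ne i : i \in openers d -> d i <> i by rewrite inE => lt E; rewrite E ltnn in lt.
have f_in i : i \in openers d -> f i \in openers d'.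
  move=> iO; rewrite /f; case: ifP => // /negbT ni.
  by have := sp i (op_ne i iO); rewrite (negPf ni); case: (_ \in _).
have f_ge i : i \in openers d -> (i <= f i)%N.
  by rewrite inE /f; case: ifP => // _ /ltnW.
have f_inj : {in openers d &, injective f}.
  move=> i j iO jO; rewrite /f; case: ifP => _; case: ifP => _ //.
  - by move=> E; move: iO jO; rewrite !inE E dK; lia.
  - by move=> E; move: iO jO; rewrite !inE -E dK; lia.
  - exact: can_inj.
have E1 : (\sum_(i in openers d) (f i).+1 = \sum_(j in f @: openers d) j.+1)%N.
  by rewrite big_imset.
have sub : f @: openers d \subset openers d'.
  by apply/subsetP=> _ /imsetP[i iO ->]; apply: f_in.
have le1 : (opener_weight d <= \sum_(i in openers d) (f i).+1)%N.
  by apply: leq_sum => i /f_ge.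
have E2 : (opener_weight d' =
    \sum_(j in f @: openers d) j.+1 + \sum_(j in openers d' :\: f @: openers d) j.+1)%N.
  by rewrite /opener_weight (big_setID (f @: openers d)) /= (setIidPr sub).
have [lt|le2] := ltnP (opener_weight d) (opener_weight d'); [by right|left].
(* The weights being equal, nothing is lost in either estimate: [f] is onto the openers of [d'] and
   moves no opener of [d]. *)
have z2 : (\sum_(j in openers d' :\: f @: openers d) j.+1 = 0)%N by lia.
have im : f @: openers d = openers d'.
  apply/eqP; rewrite eqEsubset sub; apply/subsetP => j jO; apply: contraT => jn.
  by move/eqP: z2; rewrite sum_nat_eq0 => /forallP/(_ j); rewrite inE jn jO.
have fE i : i \in openers d -> f i = i.
  move=> iO; apply: val_inj => /=; have ge := f_ge i iO.
  have : (\sum_(i in openers d) (f i).+1 = \sum_(i in openers d) i.+1)%N.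
    by apply/eqP; rewrite eqn_leq; apply/andP; split; [rewrite -/(opener_weight d); lia|].
  rewrite (bigD1 i) //= [X in _ = X](bigD1 i) //= => E.
  have : (\sum_(k in openers d | k != i) k.+1 <= \sum_(k in openers d | k != i) (f k).+1)%N.
    by apply: leq_sum => k /andP[/f_ge].
  move: E; set a := (\sum_(k in openers d | _) _)%N; set b := (\sum_(k in openers d | _) _)%N.
  by move: a b => a b; lia.
apply: openers_inj => //; rewrite -im; apply/setP=> i; apply/idP/imsetP => [iO|[j jO ->]].
  by exists i; rewrite ?fE.
by rewrite fE.
Qed.

Hypothesis N_even : ~~ odd N.

(** Of a vertical edge exactly one end is an opener; the ends of an added arc are fixed by [d], so
    neither is. *)
Lemma basic_openers D : D \in symTL N -> basic (openers (left_part D)) D.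
Proof.
move=> /symTL_left[dP DK]; set d := left_part D in dP DK *.
have mC := closureP N_even dP; have /is_closureP[mP mN md mt] := mC.
have /planarP[dK _ _] := dP; rewrite /basic; apply/andP; split.
  rewrite -DK; apply/compatibleP=> i; apply/eqP.
  have [->//|/eqP ne] := eqVneq (d i) i; rewrite -(md _ ne) twist_match // (md _ ne) !inE dK.
  have ne' : d i <> i :> nat by move/val_inj. 
  by have [] := ltngtP (d i) i.
rewrite -/d; apply/forallP=> h; apply/implyP=> /eqP hh.
rewrite twist_match // !inE hh (closure_fixed dP mC hh) !ltnn.
by [].
Qed.

Lemma basic_split I D i : D \in symTL N -> basic I D -> left_part D i <> i ->
  (left_part D i \in I) != (i \in I).
Proof.
move=> /symTL_left[dP DK] /andP[cI _]; rewrite -DK in cI; set d := left_part D in dP DK cI *.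
have /is_closureP[mP mN md mt] := closureP N_even dP => ne.
by have := (compatibleP _ _ cI) i; rewrite -(md _ ne) => /eqP; rewrite twist_match.
Qed.

End Triangularity.

(** * Pfaffians are alternating *)

Section AdjacentSwap.
Variable N : nat.
Implicit Types (pi : {ffun 'I_N -> 'I_N}) (e f : 'I_N).

Definition conjugate (s : {perm 'I_N}) pi : {ffun 'I_N -> 'I_N} := [ffun i => s (pi (s i))].

Lemma conjugateK (a b : 'I_N) : involutive (conjugate (tperm a b)).
Proof. by move=> pi; apply/ffunP=> i; rewrite !ffunE !tpermK. Qed.

Lemma conjugate_matchings (a b : 'I_N) pi :
  (conjugate (tperm a b) pi \in matchings 'I_N) = (pi \in matchings 'I_N).
Proof.
suff S pi' : pi' \in matchings 'I_N -> conjugate (tperm a b) pi' \in matchings 'I_N.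
  by apply/idP/idP=> /S; rewrite ?conjugateK.
rewrite !inE => /forallP M; apply/forallP=> i; rewrite !ffunE tpermK.
have /andP[/eqP -> ne] := M (tperm a b i); rewrite tpermK eqxx /=.
by rewrite -{2}[i](tpermK a b) (inj_eq perm_inj).
Qed.

Lemma tperm_ltn (a b x y : 'I_N) : b = a.+1 :> nat -> x != y ->
  (tperm a b x < tperm a b y)%N = (x < y)%N (+) (((x == a) && (y == b)) || ((x == b) && (y == a))).
Proof.
move=> ab; rewrite -!val_eqE /= => xy.
case: tpermP => [->|->|/eqP + /eqP]; case: tpermP => [->|->|/eqP + /eqP]; rewrite -?val_eqE /=; lia.
Qed.

(** The inversions of [pi] as ordered pairs, in both orders and without the pairs (e, pi e). By the
    count of crossings and nestings, the size modulo 8 is governed by the parity of [cn pi]. *)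
Let disordered pi : {set 'I_N * 'I_N} :=
  [set ef : 'I_N * 'I_N | [&& ef.1 != ef.2, ef.2 != pi ef.1 & (ef.1 < ef.2)%N != (pi ef.1 < pi ef.2)%N]].

Let card_disordered pi : pi \in matchings 'I_N ->
  exists k, (#|disordered pi| = 4 * cn pi + 8 * k)%N.
Proof.
move=> piM; have piK := matchK piM.
have rT : respects pi setT by apply/forallP=> e; rewrite !inE.
have [k Ek] := card_mono_inversions piM rT; exists k.
have cnE : #|mono_crossings setT pi| = cn pi.
  by apply: eq_card => -[i j]; rewrite !inE eqxx !andbT.
pose t (ef : 'I_N * 'I_N) := (ef.2, ef.1); have tK : involutive t by case.
have -> : disordered pi = mono_inversions pi setT :|: t @^-1: mono_inversions pi setT.
  apply/setP=> -[e f]; rewrite !inE /= !eqxx !andbT.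
  have -> : (e == pi f) = (f == pi e) by rewrite eq_sym (can2_eq piK piK).
  have : (pi e == pi f) = (e == f) by apply: (can_eq piK).
  by rewrite -!val_eqE /=; case: (nat_of_ord f == pi e); lia.
rewrite cardsU (_ : _ :&: _ = set0) ?cards0 ?subn0; last first.
  by apply/setP=> -[e f]; rewrite !inE /=; lia.
by rewrite card_preimset; [rewrite Ek cnE; lia | apply: can_inj tK].
Qed.

(** The four pairs of [Q] are either all disordered or all ordered, and conjugation reverses this;
    the number of disordered pairs changes by four, hence [cn] changes parity. *)
Lemma cn_conjugate (a b : 'I_N) pi : b = a.+1 :> nat -> pi \in matchings 'I_N -> pi a != b ->
  odd (cn (conjugate (tperm a b) pi)) = ~~ odd (cn pi).
Proof.
move=> ab piM piab; have piK := matchK piM; have piN := match_neq piM.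
have [k Ek] := card_disordered piM.
have [k' Ek'] : exists k', _ := card_disordered (etrans (conjugate_matchings a b pi) piM).
have nab : a != b by rewrite -val_eqE /= ab; lia.
pose Q : {set 'I_N * 'I_N} := [set (a, b); (b, a); (pi a, pi b); (pi b, pi a)].
pose s := tperm a b; pose ss (ef : 'I_N * 'I_N) := (s ef.1, s ef.2).
have ssK : involutive ss by case=> e f; rewrite /ss /= !tpermK.
have piba : pi b != a by apply: contraNneq piab => <-; rewrite piK.
(* Conjugation by s affects only the four pairs of Q. *)
have Wx x : (x \in ss @^-1: disordered (conjugate s pi)) = (x \in disordered pi) (+) (x \in Q).
  case: x => e f; rewrite !inE /= !ffunE !tpermK !(inj_eq perm_inj) -!pair_eqE /=.
  have [->|ne] := eqVneq e f.
    apply/esym/negbTE/negP => /orP[/orP[/orP[]|]|] /andP[/eqP E /eqP E'].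
    - by move: nab; rewrite -E -E' eqxx.
    - by move: nab; rewrite -E -E' eqxx.
    - by move: nab; rewrite -(can_eq piK) -E -E' eqxx.
    - by move: nab; rewrite -(can_eq piK) -E -E' eqxx.
  have [->|ne'] := eqVneq f (pi e).
    apply/esym/negbTE/negP => /orP[/orP[/orP[]|]|] /andP[/eqP E /eqP E'].
    - by move: piab; rewrite -E E' eqxx.
    - by move: piba; rewrite -E E' eqxx.
    - by move: piba; rewrite -E' E piK eqxx.
    - by move: piab; rewrite -E' E piK eqxx.
  rewrite /= !tperm_ltn ?(inj_eq (can_inj piK)) // !(can2_eq piK piK).
  have D : ~~ ((((e == a) && (f == b)) || ((e == b) && (f == a))) &&
             (((e == pi a) && (f == pi b)) || ((e == pi b) && (f == pi a)))).
    apply/negP=> /andP[/orP[]/andP[/eqP Ee /eqP Ef] /orP[]/andP[/eqP Ee' /eqP Ef']].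
    - by move: (piN a); rewrite -Ee' Ee eqxx.
    - by move: piba; rewrite -Ee' Ee eqxx.
    - by move: piab; rewrite -Ee' Ee eqxx.
    - by move: (piN b); rewrite -Ee' Ee eqxx.
  move: D; case: (e == a); case: (f == b); case: (e == b); case: (f == a); case: (e == pi a);
    case: (f == pi b); case: (e == pi b); case: (f == pi a) => //=;
    by case: (e < f)%N; case: (pi e < pi f)%N.
have cQ : #|Q| = 4.
  rewrite /Q -!setUA !cardsU1 cards1 !inE -!pair_eqE /=.
  have apia : (a == pi a) = false by rewrite eq_sym (negPf (piN a)).
  have bpib : (b == pi b) = false by rewrite eq_sym (negPf (piN b)).
  have apib : (a == pi b) = false by rewrite eq_sym (negPf piba).
  by rewrite (can_eq piK) (negPf nab) apia bpib apib ?andbF.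
have QW x : x \in Q -> (x \in disordered pi) = ((a < b)%N != (pi a < pi b)%N).
  have nab' : pi a != pi b by rewrite (can_eq piK).
  have lt1 : (b < a)%N = ~~ (a < b)%N by move: nab; rewrite -val_eqE /=; lia.
  have lt2 : (pi b < pi a)%N = ~~ (pi a < pi b)%N by move: nab'; rewrite -val_eqE /=; lia.
  rewrite !inE => /orP[/orP[/orP[]|]|] /eqP-> /=;
    rewrite ?piK ?(eq_sym b a) ?(eq_sym (pi b) (pi a)) ?nab ?nab' /=.
  - by rewrite eq_sym piab.
  - by rewrite eq_sym piba /= lt1 lt2; case: (a < b)%N; case: (pi a < pi b)%N.
  - by rewrite piba eq_sym.
  - by rewrite piab lt1 lt2; case: (a < b)%N; case: (pi a < pi b)%N.
have : #|ss @^-1: disordered (conjugate s pi)| = #|disordered (conjugate s pi)|.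
  by rewrite card_preimset //; apply: can_inj ssK.
rewrite Ek'; have [w|w] := boolP ((a < b)%N != (pi a < pi b)%N).
  rewrite (_ : _ @^-1: _ = disordered pi :\: Q).
    have := cardsID Q (disordered pi).
    rewrite (setIidPr _); last by apply/subsetP=> x xQ; rewrite QW.
    by rewrite cQ Ek; move: #|disordered pi :\: Q| (cn pi) (cn _) => w1 w2 w3; clear; lia.
  apply/setP=> x; rewrite Wx in_setD; case xQ: (x \in Q); last by rewrite addbF.
  by rewrite QW // w.
rewrite (_ : _ @^-1: _ = disordered pi :|: Q).
  rewrite cardsU cQ Ek (_ : _ :&: _ = set0) ?cards0; first by lia.
  by apply/setP=> x; rewrite !in_setI in_set0; apply/negP=> /andP[+ xQ]; rewrite QW // (negPf w).
apply/setP=> x; rewrite Wx in_setU; case xQ: (x \in Q); last by rewrite addbF orbF.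
by rewrite QW // (negPf w).
Qed.

End AdjacentSwap.

Section Alternating.
Import GRing.Theory Num.Theory.
Local Open Scope ring_scope.
Variables (K : comNzRingType) (N : nat).
Implicit Types (A : 'M[K]_N) (s : {perm 'I_N}) (pi : {ffun 'I_N -> 'I_N}).

Definition skew A := forall i j, A j i = - A i j.

Definition permute s A : 'M[K]_N := \matrix_(i, j) A (s i) (s j).

Lemma permute_skew s A : skew A -> skew (permute s A).
Proof. by move=> sk i j; rewrite !mxE sk. Qed.

(** If [pi] does not join a and b, conjugation keeps the product and reverses the sign. If it does,
    conjugation fixes [pi] and the entry of this arc changes sign by skewness. *)
Let pf_adjacent A (a b : 'I_N) : skew A -> b = a.+1 :> nat -> pf (permute (tperm a b) A) = - pf A.
Proof.
move=> sk ab; rewrite /pf -sumrN (reindex_inj (can_inj (@conjugateK _ a b))) /=.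
apply: eq_big => [pi|pi]; rewrite conjugate_matchings // => piM.
have piK := matchK piM; have piN := match_neq piM; set s := tperm a b.
have nab : a != b by rewrite -val_eqE /= ab neq_ltn ltnSn.
have -> : entry_prod (permute s A) (conjugate s pi) = \prod_(j | (s j < s (pi j))%N) A j (pi j).
  rewrite /entry_prod (reindex_inj (@perm_inj _ s)); apply: eq_big => [j|j _].
    by rewrite ffunE tpermK.
  by rewrite mxE ffunE !tpermK.
have [piab|piab] := eqVneq (pi a) b; last first.
  rewrite -signr_odd cn_conjugate // -[in RHS]signr_odd.
  have -> : \prod_(j | (s j < s (pi j))%N) A j (pi j) = entry_prod A pi.
    apply: eq_bigl => j; rewrite tperm_ltn //; last by rewrite eq_sym.
    have [->|_] := eqVneq j a; first by rewrite (negPf piab) (negPf nab) addbF.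
    have [->|_] := eqVneq j b; last by rewrite addbF.
    rewrite /= (_ : pi b == a = false) ?addbF //.
    by apply: contraNF piab => /eqP <-; rewrite piK.
  by case: odd; rewrite /= ?expr1 ?expr0 ?mulN1r ?opprK ?mul1r.
have piba : pi b = a by rewrite -piab piK.
have -> : conjugate s pi = pi.
  apply/ffunP=> i; rewrite ffunE; rewrite /s.
  have [->|ia] := eqVneq i a; first by rewrite tpermL piba tpermL piab.
  have [->|ib] := eqVneq i b; first by rewrite tpermR piab tpermR piba.
  rewrite (tpermD (z := i)) 1?eq_sym // tpermD //.
    by rewrite -piba (can_eq piK) eq_sym.
  by rewrite -piab (can_eq piK) eq_sym.
rewrite -mulrN; congr (_ * _).
(* On the arc {a, b} the condition [s j < s (pi j)] selects b instead of a, and the factor [A b a]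
   is minus [A a b]. *)
rewrite (bigD1 b) /=; last by rewrite piba /s tpermL tpermR ab.
rewrite /entry_prod [in RHS](bigD1 a) /=; last by rewrite piab ab.
rewrite piba piab sk mulNr; congr (- (_ * _)); apply: eq_bigl => j.
have [->|ja] := eqVneq j a; first by rewrite piab /s tpermL tpermR ab andbF ltnNge leqnSn.
have [->|jb] := eqVneq j b; first by rewrite piba andbF ab ltnNge leqnSn.
rewrite /= !andbT tperm_ltn //; last by rewrite eq_sym.
by rewrite (negPf ja) (negPf jb) addbF.
Qed.

(** Induction on the distance: with s adjacent at b and t the shorter transposition, (a b) = s t s,
    which gives three changes of sign. *)
Lemma pf_tperm A (a b : 'I_N) : skew A -> a != b -> pf (permute (tperm a b) A) = - pf A.
Proof.
wlog ab : a b / (a < b)%N => [hw sk ne|].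
  have [lt|gt|/val_inj E] := ltngtP a b; first exact: hw.
    by rewrite tpermC; apply: hw; rewrite // eq_sym.
  by rewrite E eqxx in ne.
move=> sk _; have [n] := ubnP (b - a)%N; elim: n A b ab sk => // n IH A b ab sk lt.
have [E|ne] := eqVneq (b : nat) a.+1; first exact: pf_adjacent.
have lb : (b.-1 < N)%N by have := ltn_ord b; lia.
pose b' := Ordinal lb; pose s := tperm b' b; pose t := tperm a b'.
have bb' : b = b'.+1 :> nat by rewrite /=; lia.
have -> : tperm a b = (s * t * s)%g.
  have sb : s^-1%g = s by rewrite /s tpermV.
  have := tpermJ a b' s; rewrite /conjg sb mulgA -/t => ->.
  by rewrite /s tpermL tpermD // -val_eqE /=; lia.
have -> : permute (s * t * s)%g A = permute s (permute t (permute s A)).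
  by apply/matrixP=> i j; rewrite !mxE !permM.
rewrite !(pf_adjacent _ bb'); try by do ?apply: permute_skew.
by rewrite IH ?opprK ?(pf_adjacent _ bb') //; [lia | apply: permute_skew | lia].
Qed.

End Alternating.

(** By skewness the columns a and b agree as well, so exchanging the two indices fixes A and yet
    changes the sign. *)
Lemma pf_equal_rows (R : numDomainType) (N : nat) (A : 'M[R]_N) (a b : 'I_N) :
  skew A -> a != b -> (forall j, A a j = A b j) -> pf A = 0%R.
Proof.
move=> sk ab rows.
have E : permute (tperm a b) A = A.
  have cols i : A i a = A i b by rewrite sk rows -sk.
  have rowE i j : A (tperm a b i) j = A i j by case: tpermP => [->|->|//].
  have colE i j : A i (tperm a b j) = A i j by case: tpermP => [->|->|//].
  by apply/matrixP=> i j; rewrite mxE rowE colE.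
apply/eqP; have /= <- := Num.Theory.mulrn_eq0 (pf A) 2; rewrite GRing.mulr2n.
by rewrite -{1}E pf_tperm // GRing.addNr.
Qed.

(** * Evaluation of products of pfaffians *)

Lemma even_pairing (T : finType) (S : {set T}) : ~~ odd #|S| ->
  exists w : {ffun T -> T}, forall x, x \in S -> [/\ w x \in S, w (w x) = x & w x <> x].
Proof.
have [n] := ubnP #|S|; elim: n S => // n IH S lt ev.
have [->|[x xS]] := set_0Vmem S; first by exists [ffun x => x] => x; rewrite inE.
have [y yS] : exists y, y \in S :\ x.
  by apply/set0Pn; apply: contraNneq ev => E; rewrite (cardsD1 x) xS E cards0.
have cS : #|S| = #|S :\ x :\ y|.+2 by rewrite (cardsD1 x) xS (cardsD1 y) yS.
have [||w wP] := IH (S :\ x :\ y); [lia | by move: ev; rewrite cS /= negbK |].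
have yx : y != x by move: yS; rewrite in_setD1 => /andP[].
exists [ffun z => if z == x then y else if z == y then x else w z] => z zS; rewrite !ffunE.
have [->|zx] := eqVneq z x.
  by rewrite (negPf yx) eqxx; split=> //; [move: yS; rewrite in_setD1 => /andP[] | apply/eqP].
have [->|zy] := eqVneq z y.
  by rewrite eqxx; split=> //; apply/eqP; rewrite eq_sym.
have [wS wK wN] : [/\ w z \in S :\ x :\ y, w (w z) = z & w z <> z].
  by apply: wP; rewrite !in_setD1 zx zy.
by move: wS; rewrite !in_setD1 => /and3P[/negPf-> /negPf-> ->].
Qed.

Section SingleMatching.
Import GRing.Theory.
Local Open Scope ring_scope.

Lemma pf_single_matching (K : idomainType) (N : nat) (B : 'M[K]_N) (w : {ffun 'I_N -> 'I_N}) :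
  w \in matchings 'I_N -> (forall i j, (B i j != 0) = (j == w i)) -> pf B != 0.
Proof.
move=> wM Bw; have wK := matchK wM; rewrite /pf (bigD1 w) //= big1 ?addr0.
  by rewrite mulf_neq0 ?signr_eq0 //; apply/prodf_neq0 => i _; rewrite Bw.
move=> pi /andP[piM ne]; have piK := matchK piM; have piN := match_neq piM.
have [i lt ni] : exists2 i : 'I_N, (i < pi i)%N & pi i != w i.
  have [i ni] : exists i, pi i != w i.
    apply/existsP; apply: contraNT ne => /existsPn none; apply/eqP/ffunP=> i.
    by apply/eqP/negPn.
  have [lt|gt|/val_inj E] := ltngtP i (pi i).
  - by exists i.
  - by exists (pi i); rewrite ?piK //; apply: contraNneq ni => {2}->; rewrite wK.
  - by move: (piN i); rewrite -E eqxx.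
rewrite /entry_prod (bigD1 i) //= (_ : B i (pi i) = 0) ?mul0r ?mulr0 //.
by apply/eqP; rewrite -[_ == _]negbK Bw.
Qed.

Lemma pf_sub_single (K : idomainType) (N : nat) (A : 'M[K]_N) (S : {set 'I_N}) (w : {ffun 'I_N -> 'I_N}) :
    (forall x, x \in S -> [/\ w x \in S, w (w x) = x & w x <> x]) ->
    (forall u v, u \in S -> v \in S -> (A u v != 0) = (v == w u)) ->
  pf_sub A S != 0.
Proof.
move=> wP Aw; have wS (s : 'I_#|S|) : w (enum_val s) \in S by case: (wP _ (enum_valP s)).
have rE s : enum_val (restrict_matching S w s) = w (enum_val s) by rewrite restrict_matchingE.
apply: (@pf_single_matching _ _ _ (restrict_matching S w)) => [|s t].
  rewrite inE; apply/forallP=> s; have [_ wK wN] := wP _ (enum_valP s).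
  by rewrite -!(inj_eq enum_val_inj) !rE wK eqxx; apply/eqP.
by rewrite mxE Aw ?enum_valP // -(inj_eq enum_val_inj) rE.
Qed.

Lemma pf_sub_equal_rows (R : numDomainType) (N : nat) (A : 'M[R]_N) (S : {set 'I_N}) (a b : 'I_N) :
  skew A -> a != b -> (forall j, A a j = A b j) -> a \in S -> b \in S -> pf_sub A S = 0.
Proof.
move=> sk ab rows /enum_val_onto[s Es] /enum_val_onto[t Et].
apply: (@pf_equal_rows _ _ _ s t) => [i j||j]; rewrite ?mxE ?Es ?Et //.
by apply: contraNneq ab => E; rewrite -Es -Et E.
Qed.

Lemma pf_compl_map (K L : comNzRingType) (f : {rmorphism K -> L}) (N : nat) (A : 'M[K]_N) I :
  pf_compl (map_mx f A) I = f (pf_compl A I).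
Proof.
have E S : pf_sub (map_mx f A) S = f (pf_sub A S).
  rewrite /pf_sub /pf rmorph_sum; apply: eq_bigr => pi _.
  rewrite rmorphM rmorphXn rmorphN1 rmorph_prod; congr (_ * _).
  by apply: eq_bigr => s _; rewrite !mxE.
by rewrite /pf_compl !E rmorphM.
Qed.

Lemma generic_skew_eval (R : comNzRingType) (N : nat) (A : 'M[R]_N) :
  skew A -> (forall i, A i i = 0) ->
  exists v : 'I_#|{: upper N}| -> R, map_mx (meval v) (generic_skew R N) = A.
Proof.
move=> sk diag.
pose v (k : 'I_#|{: upper N}|) : R := A (val (enum_val k)).1 (val (enum_val k)).2.
exists v; have ev i j : meval v (indet R i j) = if (i < j)%N then A i j else 0.
  rewrite /indet; case: insubP => [p ij Ep|/= /negPf->]; last exact: meval0.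
  by rewrite mevalXU /v enum_rankK Ep ij.
apply/matrixP=> i j; rewrite !mxE mevalB !ev.
have [lt|gt|/val_inj->] := ltngtP i j; rewrite ?subr0 ?diag //.
by rewrite sub0r -sk.
Qed.

End SingleMatching.

Section EvaluationMatrix.
Import GRing.Theory Num.Theory.
Local Open Scope ring_scope.
Variables (R : numDomainType) (N : nat) (d : {ffun 'I_N -> 'I_N}).
Hypotheses (N_even : ~~ odd N) (dP : planar d) (d_even : ~~ odd #|openers d|).
Local Notation O := (openers d).

Let dK : involutive d. Proof. by case/planarP: dP. Qed.

(** [rho] identifies the two ends of each arc, leaving the openers and the fixed points. Each of
    these two sets has even size and is paired off, by [w1] and [w2]; the entries 1 and -1 sit at
    the paired classes. In O, and likewise in its complement, a class has at most one
    representative, so a single matching contributes to each pfaffian. *)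
Lemma evaluation_matrix : exists A : 'M[R]_N,
  [/\ skew A, forall i, A i i = 0, forall i j, A i j = A (d i) j,
      pf_sub A O != 0 & pf_sub A (~: O) != 0].
Proof.
pose F := [set h | d h == h].
have F_even : ~~ odd #|F|.
  have oC : odd #|~: F| = false.
    by apply: (odd_card_fpf (f := d)) => i; rewrite !inE ?dK // eq_sym.
  have := congr1 odd (cardsC F); rewrite card_ord oddD oC addbF => ->; exact: N_even.
have [w1 w1P] := even_pairing d_even; have [w2 w2P] := even_pairing F_even.
have OE i : (i \in O) = (i < d i)%N by rewrite inE.
have FE i : (i \in F) = (d i == i) by rewrite inE.
have OF i : i \in O -> i \in F = false by rewrite OE FE => lt; apply/eqP=> E; rewrite E ltnn in lt.
have FO i : i \in F -> i \in O = false by move=> iF; apply/negP=> /OF; rewrite iF.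
pose rho v := if (d v < v)%N then d v else v.
pose w x := if x \in O then w1 x else w2 x.
have rho_in v : (rho v \in O) || (rho v \in F).
  have [lt|gt|/val_inj E] := ltngtP (d v) v.
  - by rewrite /rho lt OE dK lt.
  - by rewrite /rho ltnNge (ltnW gt) /= OE gt.
  - by rewrite /rho E ltnn FE E eqxx orbT.
have wP x : (x \in O) || (x \in F) -> [/\ (w x \in O) || (w x \in F), w (w x) = x & w x <> x].
  rewrite /w; case xO: (x \in O) => /= xF.
    by have [w1O w1K w1N] := w1P x xO; rewrite w1O.
  have [w2F w2K w2N] := w2P x xF; rewrite w2F orbT.
  by rewrite (FO _ w2F).
pose A : 'M[R]_N := \matrix_(u, v) if rho v == w (rho u) then
    (if (rho u < rho v)%N then 1 else -1) else 0.
have AE u v : (A u v != 0) = (rho v == w (rho u)).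
  rewrite mxE; case: (rho v == _); rewrite ?eqxx //.
  by case: ltnP; rewrite ?oppr_eq0 oner_eq0.
have rhoO u : u \in O -> rho u = u.
  by rewrite OE /rho => lt; rewrite ltnNge (ltnW lt).
have rhoF u : d u = u -> rho u = u by rewrite /rho => ->; rewrite ltnn.
have rhoC u : (d u < u)%N -> rho u = d u by rewrite /rho => ->.
exists A; split.
- move=> u v; rewrite !mxE; have [wL wK wN] := wP _ (rho_in u); have [wL' wK' wN'] := wP _ (rho_in v).
  have -> : (rho u == w (rho v)) = (rho v == w (rho u)).
    by apply/eqP/eqP => ->; rewrite ?wK ?wK'.
  case: eqP => [E|_]; last by rewrite oppr0.
  have ne : rho v <> rho u :> nat by move/val_inj; rewrite E.
  by case: ltngtP => [lt|lt|E']; rewrite ?opprK //; case: ne.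
- move=> i; apply/eqP; rewrite -[_ == _]negbK AE; apply/eqP=> E.
  by case: (wP _ (rho_in i)) => _ _ []; rewrite -E.
- move=> i j; rewrite !mxE; have -> // : rho (d i) = rho i.
  by rewrite /rho dK; case: ltngtP => [||/val_inj].
- apply: (@pf_sub_single _ _ _ _ w1) => // u v uO vO.
  by rewrite AE !rhoO // /w uO.
(* The complement of O consists of the fixed points and the closers; on the latter the pairing [w1]
   is transported by [d]. *)
- pose w3 : {ffun 'I_N -> 'I_N} := [ffun u => if d u == u then w2 u else d (w1 (d u))].
  have CE u : u \in ~: O -> d u = u \/ (d u < u)%N /\ d u != u.
    rewrite inE OE -leqNgt leq_eqVlt => /orP[/eqP/val_inj->|lt]; [by left|right].
    by split=> //; apply: contraTneq lt => ->; rewrite ltnn.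
  have dO u : (d u < u)%N -> d u \in O by move=> lt; rewrite OE dK.
  apply: (@pf_sub_single _ _ _ _ w3) => [u uC|u v uC vC].
    rewrite /w3 !ffunE; have [E|[lt ne]] := CE u uC.
      have uF : u \in F by rewrite FE E.
      have [w2F w2K w2N] := w2P u uF; have := w2F; rewrite FE => E2.
      rewrite E eqxx E2; split=> //.
      by rewrite in_setC (FO _ w2F).
    have [w1O w1K w1N] := w1P _ (dO u lt); rewrite (negPf ne) dK w1K dK.
    have w1lt : (w1 (d u) < d (w1 (d u)))%N by rewrite -OE.
    have -> : (w1 (d u) == d (w1 (d u))) = false.
      by apply/eqP=> Eq; rewrite -Eq ltnn in w1lt.
    split=> //; first by rewrite inE OE dK ltnNge (ltnW w1lt).
    by move=> Eq; apply: w1N; rewrite -{2}Eq dK.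
  rewrite AE /w3 ffunE; have [E|[lt ne]] := CE u uC.
    have uF : u \in F by rewrite FE E.
    have [w2F w2K w2N] := w2P u uF; have uO : u \in O = false by apply/negbTE; rewrite inE in uC.
    rewrite (rhoF _ E) E eqxx /w uO; have [Ev|[ltv nev]] := CE v vC; first by rewrite rhoF.
    rewrite rhoC //; apply/eqP/eqP => Eq.
      by have := OF _ (dO _ ltv); rewrite Eq w2F.
    by move: w2F; rewrite -Eq FE (negPf nev).
  have [w1O w1K w1N] := w1P _ (dO u lt).
  rewrite (rhoC u lt) (negPf ne) /w (dO u lt); have [Ev|[ltv nev]] := CE v vC; last first.
    by rewrite rhoC // (can2_eq dK dK).
  rewrite rhoF //; apply/eqP/eqP => Eq.
    by have := OF _ w1O; rewrite -Eq FE Ev eqxx.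
  by have := OF _ w1O; rewrite FE -Eq -{1}Ev Eq dK eqxx.
Qed.

End EvaluationMatrix.

(** * The basis *)

Section Span.
Import GRing.Theory.
Local Open Scope ring_scope.
Variables (F : fieldType) (V : lmodType F) (J : finType) (S : {set J}) (v : J -> V).

Lemma lin_span_gen j : j \in S -> lin_span S v (v j).
Proof.
move=> jS; exists (fun k => (k == j)%:R); rewrite (bigD1 j) //= eqxx scale1r big1 ?addr0 // => k.
by case/andP=> _ /negPf->; rewrite scale0r.
Qed.

Lemma lin_spanB p q : lin_span S v p -> lin_span S v q -> lin_span S v (p - q).
Proof.
move=> [c ->] [c' ->]; exists (fun j => c j - c' j); rewrite -sumrB.
by apply: eq_bigr => j _; rewrite scalerBl.
Qed.

Lemma lin_span_sum (L : finType) (P : pred L) (p : L -> V) :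
  (forall l, P l -> lin_span S v (p l)) -> lin_span S v (\sum_(l | P l) p l).
Proof.
move=> H; elim/big_ind: _ => [|a b Ha Hb|//].
  by exists (fun _ => 0); rewrite big1 // => j _; rewrite scale0r.
rewrite -[b]opprK; apply: lin_spanB => //; rewrite -sub0r; apply: lin_spanB => //.
by exists (fun _ => 0); rewrite big1 // => j _; rewrite scale0r.
Qed.

(** Apply to a linear relation the functional of an index of maximal [mu] among those with nonzero
    coefficient. *)
Lemma lin_indep_triangular (mu : J -> nat) :
  (forall j0, j0 \in S -> exists f : {scalar V},
     f (v j0) != 0 /\ forall j, j \in S -> j != j0 -> (mu j <= mu j0)%N -> f (v j) = 0) ->
  lin_indep S v.
Proof.
move=> H c c0 j jS; apply/eqP/negPn/negP => cj.
pose P := [pred k | (k \in S) && (c k != 0)]; have Pj : P j by rewrite /= jS.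
case: (arg_maxnP mu Pj) => j0 /= /andP[j0S cj0] j0max.
have [f [fj0 f0]] := H j0 j0S; have := congr1 f c0.
rewrite linear0 linear_sum (bigD1 j0) //= linearZ /= big1 ?addr0.
  by move/eqP; rewrite mulf_eq0 (negPf cj0) (negPf fj0).
move=> k /andP[kS kj0]; rewrite linearZ /=.
have [->|ck] := eqVneq (c k) 0; first by rewrite mul0r.
by rewrite f0 ?mulr0 //; apply: j0max; rewrite /= kS.
Qed.

End Span.

Section Basis.
Import GRing.Theory Num.Theory.
Local Open Scope ring_scope.
Variables (R : realFieldType) (N : nat) (emb : {ffun 'I_N -> 'I_N} -> seq (strip N)).
Hypotheses (N_gt0 : (0 < N)%N) (N_even : ~~ odd N).
Hypothesis emb_nice : forall pi, pi \in matchings 'I_N -> nice_embedding (emb pi) pi.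
Implicit Types D : diagram N.
Local Notation gen := (generic_skew R N).
Local Notation Pf := (TL_pfaf emb gen).
Local Notation op D := (openers (left_part D)).
Local Notation mu D := (opener_weight (left_part D)).

Let even_op D : D \in even_symTL N -> D \in symTL N /\ ~~ odd #|op D|.
Proof.
rewrite inE => /andP[DTL]; have [/planarP[dK _ _] {1}<-] := symTL_left DTL.
by rewrite card_left_edges.
Qed.

Let split_weight D0 D : D0 \in symTL N -> D \in symTL N ->
    (forall i, left_part D0 i <> i -> (left_part D0 i \in op D) != (i \in op D)) ->
  D0 = D \/ (mu D0 < mu D)%N.
Proof.
move=> /symTL_left[P0 K0] /symTL_left[P K] sp.
have [E|] := split_edges_weight P0 P sp; last by right.
by left; rewrite -K0 -K E.
Qed.

(** The expansion of the product for I = [op D], solved for the term of D; the remaining terms have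
    smaller weight by [basic_weight]. *)
Let opener_expansion D : D \in even_symTL N ->
  Pf D = pf_compl gen (op D) -
    \sum_(D2 in even_symTL N | basic (op D) D2 && (D2 != D)) Pf D2.
Proof.
move=> DS; have [DTL ev] := even_op DS; rewrite (pf_compl_TL N_gt0 N_even emb_nice) //.
rewrite (bigD1 D) /=; last by rewrite DS basic_openers.
rewrite (eq_bigl (fun D2 => (D2 \in even_symTL N) && (basic (op D) D2 && (D2 != D)))) ?addrK // => D2.
by rewrite andbA.
Qed.

Let basic_weight D D2 : D \in even_symTL N -> D2 \in even_symTL N -> basic (op D) D2 -> D2 != D ->
  (mu D2 < mu D)%N.
Proof.
move=> /even_op[DTL _] /even_op[D2TL _] b ne.
have [E|//] := split_weight D2TL DTL (fun i => basic_split N_even D2TL b).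
by rewrite E eqxx in ne.
Qed.

Let Pf_in_space D : D \in even_symTL N -> pf_space (Pf D).
Proof.
have [n] := ubnP (mu D); elim: n D => // n IH D lt DS.
have [DTL ev] := even_op DS; rewrite opener_expansion //; apply: lin_spanB.
  by apply: lin_span_gen; rewrite inE.
apply: lin_span_sum => D2 /and3P[D2S b ne]; apply: IH => //.
exact: leq_trans (basic_weight DS D2S b ne) lt.
Qed.

(** If I has both ends of an edge of D0 on one side, then one of the two factors is the pfaffian of
    a matrix with two equal rows. *)
Let evaluation D0 : D0 \in even_symTL N -> exists v,
  (forall I, meval v (pf_compl gen I) != 0 ->
     forall i, left_part D0 i <> i -> (left_part D0 i \in I) != (i \in I)) /\
  meval v (pf_compl gen (op D0)) != 0.
Proof.
move=> D0S; have [D0TL ev] := even_op D0S; have [dP _] := symTL_left D0TL.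
have [A [sk diag rows n1 n2]] := @evaluation_matrix R N _ N_even dP ev.
have [v Ev] := generic_skew_eval sk diag; exists v; split; last first.
  by rewrite -pf_compl_map Ev mulf_neq0.
move=> I; rewrite -pf_compl_map Ev => nz i ne.
apply: contraNN nz => /eqP same; have ne' : i != left_part D0 i by rewrite eq_sym; apply/eqP.
rewrite /pf_compl; case iI : (i \in I); rewrite iI in same.
  by rewrite (pf_sub_equal_rows sk ne' (rows i)) ?mul0r.
by rewrite mulrC (pf_sub_equal_rows sk ne' (rows i)) ?mul0r // inE ?iI ?same.
Qed.

(** By induction on the weight only the product for [op D] remains. Were it nonzero, [op D] would
    separate the ends of every edge of D0, which forces D = D0 or a weight larger than that of
    D0. *)
Let Pf_eval D0 v : D0 \in even_symTL N ->
    (forall I, meval v (pf_compl gen I) != 0 ->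
     forall i, left_part D0 i <> i -> (left_part D0 i \in I) != (i \in I)) ->
  forall D, D \in even_symTL N -> D != D0 -> (mu D <= mu D0)%N -> meval v (Pf D) = 0.
Proof.
move=> D0S vP D; have [n] := ubnP (mu D); elim: n D => // n IH D lt DS ne le.
rewrite opener_expansion // mevalB (raddf_sum (meval v)) big1 => [|D2 /and3P[D2S b ne2]]; last first.
  have lt2 := basic_weight DS D2S b ne2.
  apply: IH => //; [exact: leq_trans lt2 lt | | exact: ltnW (leq_trans lt2 le)].
  by apply: contraTneq lt2 => ->; rewrite -leqNgt.
rewrite subr0; apply/eqP/negPn/negP => /vP sp.
have [D0TL _] := even_op D0S; have [DTL _] := even_op DS.
by have [E|] := split_weight D0TL DTL sp; [rewrite E eqxx in ne | rewrite ltnNge le].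
Qed.

Lemma TL_pfaf_basis : is_basis (even_symTL N) Pf (@pf_space R N).
Proof.
split; first exact: Pf_in_space.
  apply: (lin_indep_triangular (mu := fun D => mu D)) => D0 D0S.
  have [v [vP v0]] := evaluation D0S.
  have zero := Pf_eval D0S vP; exists (meval v); split; last exact: zero.
  (* The other terms in the expansion of [Pf D0] have smaller weight and vanish at [v]. *)
  suff E : (Pf D0).@[v] = (pf_compl gen (op D0)).@[v] by rewrite [X in X != 0]E.
  rewrite opener_expansion // mevalB (raddf_sum (meval v)) big1 ?subr0 // => D2 /and3P[D2S b ne].
  by apply: zero => //; apply/ltnW/basic_weight.
move=> p [c ->]; apply: lin_span_sum => I IE.
rewrite inE in IE; rewrite (pf_compl_TL N_gt0 N_even emb_nice) // scaler_sumr.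
apply: lin_span_sum => D /andP[DS _].
exists (fun D' => (D' == D)%:R * c I).
rewrite (bigD1 D) //= eqxx mul1r big1 ?addr0 // => D' /andP[_ /negPf->].
by rewrite mul0r scale0r.
Qed.

End Basis.

Theorem theorem20 (R : realType) (n : nat)
    (emb : {ffun 'I_(2 * n) -> 'I_(2 * n)} -> seq (strip (2 * n))) :
  (1 <= n)%N ->
  (forall pi, pi \in matchings 'I_(2 * n) -> nice_embedding (emb pi) pi) ->
  is_basis (even_symTL (2 * n)) (TL_pfaf emb (generic_skew R (2 * n)))
    (@pf_space R (2 * n)).
Proof.
move=> n_gt0; apply: TL_pfaf_basis; first by rewrite muln_gt0.
by rewrite oddM.
Qed.
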